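(* There exist absolute constants $c_0,c_1,c_2>0$ for which the following holds. Let $x\ge1$, assume that $N\ge c_0M$, and let $X$ be the standard Gaussian vector in $\mathbb{R}^M$. There exists a mean-zero, variance one random variable $\zeta$ that is independent of $X$ and for which the following holds. Fix $t^*\in\mathbb{R}^M$ and consider the model $Y=\langle X,t^*\rangle+\zeta$. With probability at least $c_1/x$, ERM produces $\hat t\in\operatorname{arg\,min}_{t\in\mathbb{R}^M}\sum_{i=1}^N(Y_i-\langle X_i,t\rangle)^2$ that satisfies $$\|\hat t-t^*\|_2^2=R(\hat t)-R(t^* )\ge\frac{c_2xM}{N}.$$
   Context: $N$ and $M$ are positive integers. $(X_i,Y_i)_{i=1}^N$ are $N$ independent copies of $(X,Y)$, and probability refers to this sample. $\|\cdot\|_2$ and $\langle\cdot,\cdot\rangle$ are the Euclidean norm and inner product on $\mathbb{R}^M$. $R(t)=\mathbb{E}(Y-\langle X,t\rangle)^2$ is the squared risk of $t\in\mathbb{R}^M$; for the sample-dependent $\hat t$, $R(\hat t)$ is this function evaluated at $\hat t$ (i.e. the conditional expectation given the sample, with $(X,Y)$ independent of the sample). ERM is empirical risk minimization, i.e. the choice of a minimizer $\hat t$ as displayed. Absolute constants do not depend on $x,N,M,t^*$. *)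

(* Defs.v *)
From HB Require Import structures.
From mathcomp Require Import all_boot all_order all_algebra.
From mathcomp Require Import all_classical all_reals all_analysis.

Set Implicit Arguments.
Unset Strict Implicit.
Unset Printing Implicit Defensive.

Import Order.TTheory GRing.Theory Num.Theory.
Import numFieldNormedType.Exports.

Local Open Scope classical_set_scope.
Local Open Scope ring_scope.

Section Euclidean.
Context {R : realType} {M : nat}.

Definition dotp (u v : 'rV[R]_M) : R := \sum_(j < M) u 0 j * v 0 j.

Definition norm2 (u : 'rV[R]_M) : R := Num.sqrt (dotp u u).

(* Random vectors take values in [M.-tuple R], the type that carries the
   product sigma-algebra; linear algebra happens in ['rV[R]_M]. *)
Definition tuple_vec (u : M.-tuple R) : 'rV[R]_M := \row_j tnth u j.

End Euclidean.

Section Laws.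
Context {R : realType}.

Definition same_law d1 (T1 : measurableType d1) (P1 : probability T1 R)
    d2 (T2 : measurableType d2) (P2 : probability T2 R)
    d (V : measurableType d) (f : T1 -> V) (g : T2 -> V) : Prop :=
  forall A : set V, measurable A -> P1 (f @^-1` A) = P2 (g @^-1` A).

Definition independent_pair d (T : measurableType d) (P : probability T R)
    d1 (V1 : measurableType d1) d2 (V2 : measurableType d2)
    (f : T -> V1) (g : T -> V2) : Prop :=
  forall (A : set V1) (B : set V2), measurable A -> measurable B ->
    P (f @^-1` A `&` g @^-1` B) = (P (f @^-1` A) * P (g @^-1` B))%E.

(* The product rule for proper subfamilies is the case where the remaining
   [A i] are [setT]. *)
Definition independent_family d (T : measurableType d) (P : probability T R)
    d' (V : measurableType d') (n : nat) (f : 'I_n -> T -> V) : Prop :=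
  forall A : 'I_n -> set V, (forall i, measurable (A i)) ->
    P (\bigcap_i (f i @^-1` A i)) = (\prod_(i < n) P (f i @^-1` A i))%E.

Definition standard_gaussian d (T : measurableType d) (P : probability T R)
    (M : nat) (X : T -> M.-tuple R) : Prop :=
  independent_family P (fun (j : 'I_M) w => tnth (X w) j) /\
  forall (j : 'I_M) (A : set R), measurable A ->
    P ((fun w => tnth (X w) j) @^-1` A) = normal_prob 0 1 A.

End Laws.

Section Regression.
Context {R : realType} {M : nat}.

Definition linear_model (T : Type) (X : T -> M.-tuple R) (zeta : T -> R)
    (tstar : 'rV[R]_M) (w : T) : R :=
  dotp (tuple_vec (X w)) tstar + zeta w.

Definition risk d (T : measurableType d) (P : probability T R)
    (X : T -> M.-tuple R) (Y : T -> R) (t : 'rV[R]_M) : \bar R :=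
  'E_P[fun w => (Y w - dotp (tuple_vec (X w)) t) ^+ 2].

Definition empirical_loss (N : nat) (z : 'I_N -> M.-tuple R * R)
    (t : 'rV[R]_M) : R :=
  \sum_(i < N) ((z i).2 - dotp (tuple_vec (z i).1) t) ^+ 2.

Definition is_erm (N : nat) (z : 'I_N -> M.-tuple R * R)
    (t : 'rV[R]_M) : Prop :=
  forall s : 'rV[R]_M, empirical_loss z t <= empirical_loss z s.

End Regression.

(* Main.v *)
Require Import Defs.
From HB Require Import structures.
From mathcomp Require Import all_boot all_order all_algebra.
From mathcomp Require Import all_classical all_reals all_analysis.
From mathcomp Require Import measurable_realfun ring lra zify.

Set Implicit Arguments.
Unset Strict Implicit.
Unset Printing Implicit Defensive.

Import Order.TTheory GRing.Theory Num.Theory.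
Import numFieldNormedType.Exports.

Local Open Scope classical_set_scope.
Local Open Scope ring_scope.

(** The noise is rare and large: with [p = 1 / (2 x N)] it equals
    [1 / sqrt p] or [- 1 / sqrt p] with probability [p / 2] each and vanishes
    otherwise. With probability of order [N p], hence of order [1 / x], exactly
    one observation [k] of the sample is noisy, and least squares pays for it:
    if [v] is the estimation error, [G = \sum_i x_i x_i^T] the Gram operator of
    the design and [e] the noise of observation [k], the normal equations read
    [G v = e x_k]. Since [G x_k] has size about [N |x_k|] and [|x_k|^2] is
    about [M], the error [|v|^2] is about [e^2 M / N^2], that is [x M / N].

    Neither the inverse nor the spectrum of [G] has to be controlled. Pairing
    the normal equations with [x_k] gives [e |x_k|^2 = dotp v (G x_k)], and
    Cauchy-Schwarz turns this into [|v|^2 >= e^2 |x_k|^4 / |G x_k|^2]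
    (lemma [erm_error_ge]). So it suffices that [|x_k|^2 >= M / 2] and that
    [|G x_k|^2] is at most a multiple of [N^2 M], with probability bounded
    below. Splitting [G x_k] into [|x_k|^2 x_k] and [B x_k], where [B] is the
    Gram operator of the other rows, this is a matter of the first two moments
    of [|x_k|^2] and the second moment of [|B x_k|], which are sums of
    expectations of monomials in independent standard Gaussian
    entries ([has_mean_row_sqnorm_sqr], [has_mean_interaction]): most monomials
    contain an entry with exponent one and drop out.

    These moment bounds are combined into one polynomial below the indicator
    of the desired event ([minorant]). Its product with the indicator of a noise
    pattern is again a combination of products over independent variables, so
    its mean factorizes ([has_mean_minorant]); the noise patterns for different
    [k] being disjoint, the [N] contributions add up ([good_event]).

    This rests on the product formula for expectations over independent
    families ([has_mean_prod]) and on the moments of the standard normal law,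
    which are obtained from its exponential moments. The constants
    [c1] and [c2] depend on the fourth moment [kappa] only, and [c0 = 1]. *)

(** * Integration against a weighted image measure *)

Section WeightedPushforward.
Local Open Scope ereal_scope.
Context d (T : measurableType d) d' (V : measurableType d') (R : realType).
Variables (mu : {measure set T -> \bar R}) (nu : {measure set V -> \bar R}).
Variables (f : T -> V) (W : T -> R).
Hypotheses (mf : measurable_fun setT f) (mW : measurable_fun setT W).
Hypothesis W0 : forall x, (0 <= W x)%R.
Hypothesis nuE : forall A, measurable A ->
  nu A = \int[mu]_x ((W x)%:E * (\1_A (f x))%:E).

Import HBNNSimple.

Let nnsfun_weighted (g : {nnsfun V >-> R}) :
  \int[nu]_y (g y)%:E = \int[mu]_x ((W x)%:E * (g (f x))%:E).
Proof.
rewrite integralT_nnsfun sintegralE.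
transitivity (\int[mu]_x (\sum_(r \in range g)
   (r%:E * ((W x)%:E * (\1_(g @^-1` [set r]) (f x))%:E)))); last first.
  apply: eq_integral => x _; rewrite (fimfunE g) -fsumEFin// ge0_mule_fsumr//.
    by apply: eq_fsbigr => r _; rewrite EFinM muleCA.
  by move=> r; rewrite nnfun_muleindic_ge0.
have mterm r : measurable_fun setT
    (fun x => (W x)%:E * (\1_(g @^-1` [set r]) (f x))%:E).
  apply: emeasurable_funM; apply/measurable_EFinP => //.
  by apply: measurableT_comp => //; exact: measurable_indic.
have t0 r x : 0 <= (W x)%:E * (\1_(g @^-1` [set r]) (f x))%:E.
  by rewrite mule_ge0// lee_fin.
rewrite ge0_integral_fsum//.
- apply: eq_fsbigr => r; rewrite inE => -[y _ <-].
  by rewrite ge0_integralZl_EFin// nuE.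
- by move=> r; apply: measurable_funeM.
- move=> r x _; have [r0|r0] := leP 0%R r; first by rewrite mule_ge0.
  by rewrite preimage_nnfun0// indic0 mule0 mule0.
Qed.

(** Both sides are determined by their values on indicators: they agree on
    simple functions by linearity, hence on their increasing limits. *)
Lemma ge0_integral_weighted_pushforward (phi : V -> \bar R) :
  measurable_fun setT phi -> (forall y, 0 <= phi y) ->
  \int[nu]_y phi y = \int[mu]_x ((W x)%:E * phi (f x)).
Proof.
move=> mphi phi0.
pose g := nnsfun_approx measurableT mphi.
have gphi y : (g n y)%:E @[n --> \oo] --> phi y.
  by apply: (cvg_nnsfun_approx measurableT mphi) => // z _; exact: phi0.
have ndg y : nondecreasing_seq (fun n => (g n y)%:E).
  by move=> m n mn; rewrite lee_fin; apply/lefP/nd_nnsfun_approx.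
transitivity (limn (fun n => \int[nu]_y (g n y)%:E)).
  rewrite -monotone_convergence//=.
  - by apply: eq_integral => y _; apply/esym/cvg_lim => //; exact: gphi.
  - by move=> n; apply/measurable_EFinP.
  - by move=> n x _; rewrite lee_fin.
under eq_fun do rewrite nnsfun_weighted.
have WE x : (0 <= (W x)%:E) by rewrite lee_fin.
rewrite -monotone_convergence//=.
- by apply: eq_integral => x _; apply/cvg_lim => //; apply: cvgeZl => //.
- move=> n; apply: emeasurable_funM; apply/measurable_EFinP => //.
  exact: measurableT_comp.
- by move=> n x _; rewrite mule_ge0// lee_fin.
- by move=> x _ m n mn; rewrite lee_wpmul2l// ndg.
Qed.

End WeightedPushforward.

(** * A calculus of expectations *)

Section Mean.
Context {R : realType} {d : measure_display} {T : measurableType d}.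
Variable P : probability T R.
Implicit Types (g h : T -> R) (m : R).

(** Integrability and the value of the integral travel together, so that an
    expectation of a polynomial can be computed term by term with real
    arithmetic only. *)
Definition has_mean g m :=
  P.-integrable setT (EFin \o g) /\ (\int[P]_w (g w)%:E = m%:E)%E.

Lemma has_mean_measurable g m : has_mean g m -> measurable_fun setT g.
Proof. by move=> [/measurable_int/measurable_EFinP]. Qed.

Lemma has_mean_unique g m m' : has_mean g m -> has_mean g m' -> m = m'.
Proof. by move=> [_ e] [_]; rewrite e => -[]. Qed.

Lemma eq_has_mean g h m : g =1 h -> has_mean g m -> has_mean h m.
Proof. by move=> /funext ->. Qed.

Lemma has_mean_cst m : has_mean (cst m) m.
Proof.
split; first exact: finite_measure_integrable_cst.
have := integral_cst P measurableT m%:E => /= ->.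
by rewrite probability_setT mule1.
Qed.

Lemma has_meanD g h m n :
  has_mean g m -> has_mean h n -> has_mean (g \+ h) (m + n).
Proof.
move=> [ig eg] [ih eh]; split.
  by have := integrableD measurableT ig ih; apply: eq_integrable.
under eq_integral do rewrite /= EFinD.
by rewrite (integralD measurableT ig ih) /= eg eh.
Qed.

Lemma has_meanZ g m c : has_mean g m -> has_mean (fun w => c * g w) (c * m).
Proof.
move=> [ig eg]; split.
  by have := integrableZl measurableT c ig; apply: eq_integrable.
under eq_integral do rewrite /= EFinM.
by rewrite (integralZl measurableT ig) /= eg.
Qed.

Lemma has_meanB g h m n :
  has_mean g m -> has_mean h n -> has_mean (g \- h) (m - n).
Proof.
move=> hg hh; have := has_meanD hg (has_meanZ (-1) hh).
by rewrite mulN1r; apply: eq_has_mean => w /=; rewrite mulN1r.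
Qed.

Lemma has_mean_sum (I : Type) (s : seq I) (p : pred I) (g : I -> T -> R) (m : I -> R) :
  (forall i, p i -> has_mean (g i) (m i)) ->
  has_mean (fun w => \sum_(i <- s | p i) g i w) (\sum_(i <- s | p i) m i).
Proof.
move=> hg; elim: s => [|i s ih].
  rewrite big_nil; apply: (eq_has_mean _ (has_mean_cst 0)) => w.
  by rewrite big_nil.
rewrite big_cons; case: ifPn => pi.
  apply: (eq_has_mean _ (has_meanD (hg _ pi) ih)) => w /=.
  by rewrite big_cons pi.
by apply: (eq_has_mean _ ih) => w; rewrite big_cons (negbTE pi).
Qed.

Lemma has_mean_indic (A : set T) : measurable A -> has_mean \1_A (fine (P A)).
Proof.
move=> mA; split; first exact: integrable_indic.
by rewrite integral_indic// setIT fineK// fin_num_measure.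
Qed.

Lemma le_has_mean g h m n :
  has_mean g m -> has_mean h n -> (forall w, g w <= h w) -> m <= n.
Proof.
move=> [ig eg] [ih eh] gh; rewrite -lee_fin -eg -eh.
by apply: le_integral => // w _; rewrite lee_fin.
Qed.

Lemma ge0_has_mean g m : measurable_fun setT g -> (forall w, 0 <= g w) ->
  (\int[P]_w (g w)%:E = m%:E)%E -> has_mean g m.
Proof.
move=> mg g0 e; split => //; apply/integrableP; split.
  exact/measurable_EFinP.
under eq_integral do rewrite /= ger0_norm//.
by rewrite e ltry.
Qed.

Lemma has_mean_dominated g h m : measurable_fun setT g ->
  (forall w, `|g w| <= h w) -> has_mean h m -> exists n, has_mean g n.
Proof.
move=> mg gh [ih _].
have ig : P.-integrable setT (EFin \o g).
  apply: le_integrable ih => //; first exact/measurable_EFinP.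
  by move=> w _; rewrite /= lee_fin (le_trans (gh w))// ler_norm.
exists (fine (\int[P]_w (g w)%:E)%E); split => //.
by rewrite fineK//; apply: integrable_fin_num ig.
Qed.

End Mean.

Section Transfer.
Context {R : realType} d1 (T1 : measurableType d1) (P1 : probability T1 R).
Context d2 (T2 : measurableType d2) (P2 : probability T2 R).
Context d (V : measurableType d) (f : T1 -> V) (g : T2 -> V).
Hypotheses (mf : measurable_fun setT f) (mg : measurable_fun setT g).
Hypothesis fg : same_law P1 P2 f g.

Let integral_same_law (phi : V -> \bar R) :
  measurable_fun setT phi -> (forall y, 0 <= phi y)%E ->
  (\int[P1]_x phi (f x) = \int[P2]_x phi (g x))%E.
Proof.
move=> mphi phi0.
have := @ge0_integral_pushforward _ _ _ _ _ f mf P1 _ _ measurableT mphi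
  (fun y _ => phi0 y).
rewrite preimage_setT /= => <-.
have := @ge0_integral_pushforward _ _ _ _ _ g mg P2 _ _ measurableT mphi
  (fun y _ => phi0 y).
rewrite preimage_setT /= => <-.
by apply: eq_measure_integral => A mA _; exact: fg.
Qed.

Lemma has_mean_same_law (phi : V -> R) m : measurable_fun setT phi ->
  has_mean P1 (phi \o f) m -> has_mean P2 (phi \o g) m.
Proof.
move=> mphi [/integrableP[_ ifin] e].
have mE : measurable_fun setT (EFin \o phi) by exact/measurable_EFinP.
split.
  apply/integrableP; split.
    by apply/measurable_EFinP; exact: measurableT_comp.
  have mabs : measurable_fun setT (abse \o (EFin \o phi)).
    exact: measurableT_comp.
  by have /= <- := integral_same_law mabs (fun y => abse_ge0 _).
have ep := integral_same_law (measurable_funepos mE) (funepos_ge0 _).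
have en := integral_same_law (measurable_funeneg mE) (funeneg_ge0 _).
rewrite -e -[LHS]/(\int[P2]_x ((EFin \o phi) \o g) x)%E.
rewrite -[RHS]/(\int[P1]_x ((EFin \o phi) \o f) x)%E integralE [RHS]integralE.
by rewrite (funepos_comp _ g) (funepos_comp _ f) (funeneg_comp _ g)
  (funeneg_comp _ f) /= ep en.
Qed.

End Transfer.

Lemma same_law_sym (R : realType) d1 (T1 : measurableType d1)
    (P1 : probability T1 R) d2 (T2 : measurableType d2) (P2 : probability T2 R)
    d (V : measurableType d) (f : T1 -> V) (g : T2 -> V) :
  same_law P1 P2 f g -> same_law P2 P1 g f.
Proof. by move=> fg A mA; rewrite fg. Qed.

(** * Expectations of products of independent variables *)

Section Independence.
Context {R : realType} {d : measure_display} {T : measurableType d}.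
Variable P : probability T R.
Context {I : finType}.

(** Real-valued families over any finite index type: a sample of vectors with
    noise is one such family, indexed by pairs. *)
Definition mutually_independent (f : I -> T -> R) :=
  forall A : I -> set R, (forall i, measurable (A i)) ->
    P (\bigcap_i (f i @^-1` A i)) = (\prod_i P (f i @^-1` A i))%E.

Lemma prod_indic_preimage (f : I -> T -> R) (A : I -> set R) w :
  \prod_i \1_(A i) (f i w) = \1_(\bigcap_i (f i @^-1` A i)) w :> R.
Proof.
rewrite [RHS]indicE; case: (boolP (w \in _)) => [|].
  rewrite inE => wA; rewrite big1// => i _.
  by rewrite indicE mem_set//; exact: wA.
rewrite notin_setE => wA; apply/eqP; rewrite prodf_seq_eq0.
apply/hasPn => /= h; apply: wA => i _.
have := h i (mem_index_enum _); rewrite indicE.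
by case: (boolP (f i w \in A i)); rewrite ?inE//= eqxx.
Qed.

Variable f : I -> T -> R.
Hypothesis mf : forall i, measurable_fun setT (f i).
Hypothesis indf : mutually_independent f.

Let has_mean_indic_comp i (A : set R) : measurable A ->
  has_mean P (\1_A \o f i) (fine (P (f i @^-1` A))).
Proof.
move=> mA; have := has_mean_indic P (mf i measurableT mA).
by rewrite setTI; apply: eq_has_mean => w /=; rewrite !indicE.
Qed.

Let has_mean_indic_prod (A : I -> set R) : (forall i, measurable (A i)) ->
  has_mean P (fun w => \prod_i \1_(A i) (f i w))
    (\prod_i fine (P (f i @^-1` A i))).
Proof.
move=> mA.
have mfA i : measurable (f i @^-1` A i) by rewrite -[X in measurable X]setTI; exact: mf.
have mcap : measurable (\bigcap_i (f i @^-1` A i)).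
  by apply: fin_bigcap_measurable => // i _; exact: mfA.
have := has_mean_indic P mcap; rewrite indf//.
rewrite (eq_bigr (fun i => (fine (P (f i @^-1` A i)))%:E)); last first.
  by move=> i _; rewrite fineK// fin_num_measure.
rewrite -(big_morph EFin EFinM erefl) /=.
by apply: eq_has_mean => w; rewrite prod_indic_preimage.
Qed.

(** The factors are turned one at a time from indicators into general functions:
    with the other factors frozen into a weight [W] of mean [c], independence
    says that [f k] has under [W dP] the law [c] times its law under [P]. *)
Lemma ge0_has_mean_prod (g : I -> R -> R) (m : I -> R) :
  (forall i, measurable_fun setT (g i)) -> (forall i x, 0 <= g i x) ->
  (forall i, has_mean P (g i \o f i) (m i)) ->
  has_mean P (fun w => \prod_i g i (f i w)) (\prod_i m i).
Proof.
suff main (s : seq I) : forall (g : I -> R -> R) (m : I -> R),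
    (forall i, measurable_fun setT (g i)) -> (forall i x, 0 <= g i x) ->
    (forall i, has_mean P (g i \o f i) (m i)) ->
    (forall i, i \notin s -> exists2 A : set R, measurable A & g i = \1_A) ->
    has_mean P (fun w => \prod_i g i (f i w)) (\prod_i m i).
  move=> mg g0 gm; apply: (main (enum I)) => // i.
  by rewrite mem_enum.
elim: s => [|k s ih] {}g {}m mg g0 gm gA.
  have /choice[A /all_and2[mA gE]] : forall i, exists A : set R,
      measurable A /\ g i = \1_A.
    by move=> i; have [A mA gE] := gA i isT; exists A.
  have -> : \prod_i m i = \prod_i fine (P (f i @^-1` A i)).
    apply: eq_bigr => i _; apply: (has_mean_unique (gm i)).
    by rewrite gE; exact: has_mean_indic_comp.
  apply: eq_has_mean (has_mean_indic_prod mA) => w.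
  by apply: eq_bigr => i _; rewrite gE.
pose W w := \prod_(i | i != k) g i (f i w).
pose c := \prod_(i | i != k) m i.
have m0 i : 0 <= m i.
  by apply: (le_has_mean (has_mean_cst P 0) (gm i)) => w; exact: g0.
have c0 : 0 <= c by apply: prodr_ge0.
have W0 w : 0 <= W w by apply: prodr_ge0.
have mW : measurable_fun setT W.
  rewrite /W; under eq_fun do rewrite -big_filter.
  by apply: measurable_prod => i _; exact: measurableT_comp.
have WA A : measurable A ->
    has_mean P (fun w => W w * \1_A (f k w)) (c * fine (P (f k @^-1` A))).
  move=> mA; pose g' i := if i == k then \1_A else g i.
  pose m' i := if i == k then fine (P (f k @^-1` A)) else m i.
  have hm : has_mean P (fun w => \prod_i g' i (f i w)) (\prod_i m' i).
    apply: ih.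
    - by move=> i; rewrite /g'; case: eqP => // _; exact: measurable_indic.
    - by move=> i x; rewrite /g'; case: eqP.
    - move=> i; rewrite /g' /m'; case: eqP => [->|_]; last exact: gm.
      exact: has_mean_indic_comp.
    - move=> i si; rewrite /g'; case: eqP => [_|/eqP ik]; first by exists A.
      by apply: gA; rewrite inE negb_or ik.
  move: hm; rewrite (bigD1 k)//= /m' eqxx mulrC.
  rewrite (eq_bigr m) => [|i /negPf->//]; apply: eq_has_mean => w.
  rewrite (bigD1 k)//= /g' eqxx mulrC; congr (_ * _).
  by apply: eq_bigr => i /negPf->.
pose fk : {mfun T >-> R} :=
  HB.pack (f k) (isMeasurableFun.Build _ _ _ _ _ (mf k)).
pose nu := mscale (NngNum c0) (distribution P fk).
have nuE A : measurable A ->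
    nu A = (\int[P]_w ((W w)%:E * (\1_A (f k w))%:E))%E.
  move=> mA; under eq_integral do rewrite -EFinM.
  rewrite (WA A mA).2 /nu /mscale /= EFinM fineK// fin_num_measure//.
  by rewrite -[X in measurable X]setTI; exact: mf.
have := ge0_integral_weighted_pushforward (mf k) mW W0 nuE
  (phi := EFin \o g k).
rewrite ge0_integral_mscale//=; last 2 first.
- exact/measurable_EFinP.
- by move=> x _; rewrite lee_fin.
rewrite ge0_integral_distribution/=; last 2 first.
- exact/measurable_EFinP.
- by move=> x; rewrite lee_fin.
rewrite (gm k).2 => -/(_ _ _)/esym eW.
rewrite (bigD1 k)//= mulrC; apply: ge0_has_mean.
- by apply: measurable_prod => i _; exact: measurableT_comp.
- by move=> w; apply: prodr_ge0.
rewrite [RHS]EFinM -eW; first last.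
- by move=> y; rewrite lee_fin.
- exact/measurable_EFinP.
by apply: eq_integral => w _; rewrite -EFinM (bigD1 k)//= mulrC.
Qed.

(** Each factor is the difference of its positive and negative parts; expanding
    the product over all sign patterns reduces to nonnegative factors. *)
Lemma has_mean_prod (g : I -> R -> R) (m : I -> R) :
  (forall i, measurable_fun setT (g i)) ->
  (forall i, has_mean P (g i \o f i) (m i)) ->
  has_mean P (fun w => \prod_i g i (f i w)) (\prod_i m i).
Proof.
move=> mg gm.
pose part i (b : bool) : R -> R := if b then (g i)^\+ else (g i)^\-.
have mpart i b : measurable_fun setT (part i b).
  by case: b; [exact: measurable_funrpos|exact: measurable_funrneg].
have part0 i b x : 0 <= part i b x.
  by case: b => /=; [exact: funrpos_ge0|exact: funrneg_ge0].
have /choice[n hn] : forall ib : I * bool, exists n,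
    has_mean P (part ib.1 ib.2 \o f ib.1) n.
  move=> [i b] /=.
  apply: (has_mean_dominated (h := fun w => `|g i (f i w)|)
    (m := fine (\int[P]_w (`|g i (f i w)|)%:E)%E)).
  - exact: measurableT_comp.
  - move=> w /=; rewrite ger0_norm//; case: b => /=.
    + by rewrite /funrpos ge_max normr_ge0 ler_norm.
    + by rewrite /funrneg ge_max normr_ge0 lerNl lerNnormlW.
  - have [[ig _] _] := (gm i, tt).
    have ia := integrable_norm ig.
    split => //; rewrite fineK//; exact: integrable_fin_num ia.
pose sg (b : bool) : R := if b then 1 else -1.
have gE i x : g i x = \sum_(b : bool) sg b * part i b x.
  rewrite big_bool /= mul1r mulN1r.
  by rewrite -[g i in LHS]funrposBneg.
have mE i : m i = \sum_(b : bool) sg b * n (i, b).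
  apply: (has_mean_unique (gm i)).
  have := @has_mean_sum _ _ _ P _ (index_enum bool) xpredT _ _
    (fun b _ => has_meanZ (sg b) (hn (i, b))).
  by apply: eq_has_mean => w /=; rewrite gE.
rewrite (eq_bigr _ (fun i _ => mE i)) bigA_distr_bigA /=.
apply: (@eq_has_mean _ _ _ _ (fun w => \sum_(s : {ffun I -> bool})
    (\prod_i sg (s i)) * \prod_i part i (s i) (f i w))).
  move=> w; rewrite (eq_bigr _ (fun i _ => gE i (f i w))) bigA_distr_bigA /=.
  by apply: eq_bigr => s _; rewrite big_split.
apply: has_mean_sum => s _; rewrite big_split /=; apply: has_meanZ.
by apply: (ge0_has_mean_prod (g := fun i => part i (s i))) => // i;
  exact: (hn (i, s i)).
Qed.

End Independence.

(** * Moments of the standard normal law *)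

Section GaussianMoments.
Context {R : realType}.
Notation mu := (@lebesgue_measure R).
Notation N01 := (@normal_prob R 0 1).

Lemma ge0_integral_normal_prob (m s : R) (phi : R -> \bar R) :
  measurable_fun setT phi -> (forall x, 0 <= phi x)%E ->
  (\int[normal_prob m s]_x phi x = \int[mu]_x ((normal_pdf m s x)%:E * phi x))%E.
Proof.
apply: (@ge0_integral_weighted_pushforward _ _ _ _ _ mu (normal_prob m s) id).
- exact: measurable_id.
- exact: measurable_normal_pdf.
- by move=> x; exact: normal_pdf_ge0.
move=> A mA.
rewrite -[LHS]/(\int[mu]_(x in A) (normal_pdf m s x)%:E)%E [LHS]integral_mkcond.
by apply: eq_integral => x _; rewrite epatch_indic.
Qed.

Lemma normal_peakE (s : R) : 0 < s -> normal_peak s = s^-1 * normal_peak 1.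
Proof.
move=> s0; rewrite /normal_peak -!mulrnAr sqrtrM ?sqr_ge0// sqrtr_sqr gtr0_norm//.
by rewrite expr1n mul1r invfM.
Qed.

(** Rescaling: the weighted density is, up to a factor, the density of
    variance [t ^- 2]. *)
Lemma has_mean_gauss_exp_sqr (t : R) : 0 < t ->
  has_mean N01 (fun x => expR ((1 - t ^+ 2) * x ^+ 2 / 2)) t^-1.
Proof.
move=> t0.
have mE : measurable_fun setT (fun x : R => expR ((1 - t ^+ 2) * x ^+ 2 / 2)).
  apply: measurableT_comp => //; apply: measurable_funM => //.
  by apply: measurable_funM => //; exact: exprn_measurable.
apply: ge0_has_mean => //.
rewrite ge0_integral_normal_prob; last 2 first.
- exact/measurable_EFinP.
- by move=> x; rewrite lee_fin expR_ge0.
transitivity (\int[mu]_x ((t^-1)%:E * (normal_pdf 0 t^-1 x)%:E))%E.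
  apply: eq_integral => x _; rewrite -!EFinM; congr (_%:E).
  rewrite !normal_pdfE ?oner_eq0 ?invr_eq0 ?gt_eqF// (@normal_peakE t^-1) ?invr_gt0//.
  rewrite invrK -(mulrA t) mulKf ?gt_eqF// -[LHS]mulrA; congr (_ * _).
  rewrite /normal_fun -expRD; congr expR.
  by field; rewrite gt_eqF.
rewrite ge0_integralZl//=.
- by rewrite integral_normal_pdf mule1.
- by apply/measurable_EFinP; exact: measurable_normal_pdf.
- by move=> x _; rewrite lee_fin normal_pdf_ge0.
- by rewrite lee_fin invr_ge0 ltW.
Qed.

(** Completing the square: the weighted density is a translated one. *)
Lemma has_mean_gauss_exp (s : R) :
  has_mean N01 (fun x => expR (s * x)) (expR (s ^+ 2 / 2)).
Proof.
have mE : measurable_fun setT (fun x : R => expR (s * x)).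
  by apply: measurableT_comp => //; apply: measurable_funM.
apply: ge0_has_mean => //.
rewrite ge0_integral_normal_prob; last 2 first.
- exact/measurable_EFinP.
- by move=> x; rewrite lee_fin expR_ge0.
transitivity (\int[mu]_x ((expR (s ^+ 2 / 2))%:E * (normal_pdf s 1 x)%:E))%E.
  apply: eq_integral => x _; rewrite -!EFinM; congr (_%:E).
  rewrite !normal_pdfE ?oner_eq0// [RHS]mulrCA -[LHS]mulrA; congr (_ * _).
  rewrite /normal_fun -!expRD; congr expR.
  by field.
rewrite ge0_integralZl//=.
- by rewrite integral_normal_pdf mule1.
- by apply/measurable_EFinP; exact: measurable_normal_pdf.
- by move=> x _; rewrite lee_fin normal_pdf_ge0.
Qed.

(** Integrating [1 + u <= expR u] with [u = (1 - t ^+ 2) * x ^+ 2 / 2] bounds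
    [1 + (1 - t ^+ 2) / 2 * m] by [t^-1] for all [t > 0], with equality at
    [t = 1]: the two sides have the same derivative there, which says
    [m = 1]. *)
Lemma has_mean_gauss_sqr : has_mean N01 (fun x => x ^+ 2) 1.
Proof.
have [m hm] : exists m, has_mean N01 (fun x => x ^+ 2) m.
  have t0 : (0 : R) < 2^-1 by [].
  apply: (has_mean_dominated _ _ (has_meanZ 3 (has_mean_gauss_exp_sqr t0))) => // x.
  rewrite ger0_norm ?sqr_ge0//.
  have := expR_ge1Dx ((1 - 2^-1 ^+ 2) * x ^+ 2 / 2).
  have := sqr_ge0 x; nra.
have key (t : R) : 0 < t -> 1 + (1 - t ^+ 2) / 2 * m <= t^-1.
  move=> t0; apply: (le_has_mean (has_meanD (has_mean_cst _ 1)
    (has_meanZ ((1 - t ^+ 2) / 2) hm)) (has_mean_gauss_exp_sqr t0)) => x /=.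
  by rewrite (_ : _ * x ^+ 2 = (1 - t ^+ 2) * x ^+ 2 / 2) ?expR_ge1Dx// mulrAC.
suff m1 : m = 1 by move: hm; rewrite m1.
have key' (t : R) : 0 < t -> (1 - t) * (t * (1 + t) * m - 2) <= 0.
  move=> t0; have := key t t0; rewrite -[leRHS]mul1r ler_pdivlMr// => h; lra.
apply/eqP; rewrite eq_sym eq_le; apply/andP.
split; rewrite leNgt; apply/negP => m1.
(* the test values are t = 2 or t = 1 + (1 - m) / 4 when m < 1, and
   t = (1 + m^-1) / 2 when m > 1 *)
- have [m0|m0] := leP m 0.
    have := key' 2 ltac:(by []); nra.
  have := key' ((5 - m) / 4) ltac:(lra).
  rewrite (_ : _ * _ = (1 - m) ^+ 2 * (m ^+ 2 - 13 * m + 32) / 64); last by field.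
  apply/negP; rewrite -ltNge divr_gt0// mulr_gt0//; last by have := sqr_ge0 m; lra.
  by rewrite exprn_gt0// subr_gt0.
- have r0 : 0 < m^-1 by rewrite invr_gt0; lra.
  have r1 : m^-1 < 1 by rewrite invf_lt1//; lra.
  have mr : m = m^-1^-1 by rewrite invrK.
  have := key' ((1 + m^-1) / 2) ltac:(lra); rewrite [X in _ * X - 2]mr.
  set r := m^-1 in r0 r1 *.
  have -> : (1 + r) / 2 * (1 + (1 + r) / 2) * r^-1 - 2 =
            (1 - r) * (3 - r) / (4 * r) by field; rewrite gt_eqF.
  rewrite (_ : 1 - (1 + r) / 2 = (1 - r) / 2); last by field.
  apply/negP; rewrite -ltNge; repeat (apply: mulr_gt0 || rewrite invr_gt0); lra.
Qed.

(** With variance one, [x] is integrable, and [s |-> 1 + s * m] lies below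
    [s |-> expR (s ^+ 2 / 2)] while touching it at [0]: its slope [m] is [0]. *)
Lemma has_mean_gauss_id : has_mean N01 id 0.
Proof.
have [m hm] : exists m, has_mean N01 id m.
  apply: (has_mean_dominated _ _ (has_meanD (has_mean_cst _ 1) has_mean_gauss_sqr)).
    exact: measurable_id.
  move=> x /=; rewrite ler_norml; have := sqr_ge0 (x - 1); have := sqr_ge0 (x + 1).
  by move=> ? ?; apply/andP; split; nra.
have key (s : R) : 1 + s * m <= expR (s ^+ 2 / 2).
  apply: (le_has_mean (has_meanD (has_mean_cst _ 1) (has_meanZ s hm))
    (has_mean_gauss_exp s)) => x /=.
  exact: expR_ge1Dx.
have [m_0|m0] := eqVneq m 0; first by move: hm; rewrite m_0.
exfalso.
have q0 : 0 < m ^+ 2 by rewrite exprn_even_gt0.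
(* the step s = e * m is small enough for the bound to fail when m != 0 *)
pose e := (1 + m ^+ 2)^-1.
have e0 : 0 < e by rewrite invr_gt0; lra.
have e1 : e * m ^+ 2 = 1 - e by rewrite /e; field; rewrite gt_eqF; lra.
have := key (e * m); have := expR_ge1Dx (- ((e * m) ^+ 2 / 2)).
rewrite (_ : e * m * m = 1 - e); last by rewrite -e1; ring.
rewrite (_ : (e * m) ^+ 2 = e * (1 - e)); last by rewrite -e1; ring.
have := expRxMexpNx_1 (e * (1 - e) / 2).
have := expR_gt0 (e * (1 - e) / 2).
have : 0 < 1 - e by rewrite -e1 mulr_gt0.
set a := expR _; set b := expR _ => h1 a0 ab h2 h3.
have h4 : a * (1 - e * (1 - e) / 2) <= a * b by rewrite ler_pM2l.
have p1 : 0 < 1 - e * (1 - e) / 2 by have := sqr_ge0 e; nra.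
have h5 : (1 + (1 - e)) * (1 - e * (1 - e) / 2) <= 1.
  by rewrite -[leRHS]ab (le_trans _ h4)// ler_wpM2r// ltW.
have : 0 < (1 - e) * (1 - e + e ^+ 2 / 2) by rewrite mulr_gt0//; nra.
lra.
Qed.

Lemma has_mean_gauss_pow4 :
  exists2 kappa : R, 0 <= kappa & has_mean N01 (fun x => x ^+ 4) kappa.
Proof.
have [k hk] : exists k, has_mean N01 (fun x => x ^+ 4) k.
  have t0 : (0 : R) < 2^-1 by [].
  (* square 1 + u <= expR u at u = 3 / 16 * x ^+ 2, half the exponent for t = 1 / 2 *)
  apply: (has_mean_dominated _ _ (has_meanZ 32 (has_mean_gauss_exp_sqr t0))) => [|x].
    exact: exprn_measurable.
  rewrite ger0_norm ?exprn_even_ge0//.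
  rewrite (_ : _ / 2 = 3 / 16 * x ^+ 2 + 3 / 16 * x ^+ 2); last by field.
  rewrite expRD (_ : x ^+ 4 = x ^+ 2 * x ^+ 2); last by rewrite -exprD.
  have := expR_ge1Dx (3 / 16 * x ^+ 2); set a := expR _; have := sqr_ge0 x.
  set q := x ^+ 2 => q0 aq.
  have : (3 / 16 * q) * (3 / 16 * q) <= a * a by apply: ler_pM; lra.
  nra.
exists k; last exact: hk.
apply: (le_has_mean (has_mean_cst N01 0) hk) => x.
by rewrite exprn_even_ge0.
Qed.

End GaussianMoments.

Lemma gaussian_moments (R : realType) : exists2 gm : nat -> R,
  [/\ gm 0%N = 1, gm 1%N = 0, gm 2%N = 1 & 0 <= gm 4%N] &
  forall n, (n <= 4)%N -> has_mean (@normal_prob R 0 1) (fun x => x ^+ n) (gm n).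
Proof.
have [kappa kappa0 h4] := has_mean_gauss_pow4 (R := R).
have [m3 h3] : exists m3, has_mean (@normal_prob R 0 1) (fun x => x ^+ 3) m3.
  apply: (has_mean_dominated _ _ (has_meanD (has_mean_cst _ 1) h4)) => [|x /=].
    exact: exprn_measurable.
  have := sqr_ge0 (x ^+ 2 - x); have := sqr_ge0 (x ^+ 2 + x).
  have := sqr_ge0 (x - 1); have := sqr_ge0 (x + 1); have := sqr_ge0 (x ^+ 2 - 1).
  by move=> *; rewrite ler_norml; apply/andP; split; nra.
exists (nth 0 [:: 1; 0; 1; m3; kappa]) => // -[|[|[|[|[|//]]]]] _ /=.
- by apply: eq_has_mean (has_mean_cst _ 1) => x; rewrite expr0.
- by apply: eq_has_mean (has_mean_gauss_id (R := R)) => x; rewrite expr1.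
- exact: has_mean_gauss_sqr.
- exact: h3.
- exact: h4.
Qed.

(** * Least squares with a single noisy response *)

Section EuclideanGeometry.
Context {R : realType} {M : nat}.
Implicit Types (u v w : 'rV[R]_M) (a : R).

Lemma dotpC u v : dotp u v = dotp v u.
Proof. by apply: eq_bigr => j _; rewrite mulrC. Qed.

Lemma dotpDr w u v : dotp w (u + v) = dotp w u + dotp w v.
Proof. by rewrite -big_split; apply: eq_bigr => j _; rewrite mxE mulrDr. Qed.

Lemma dotpZr w a u : dotp w (a *: u) = a * dotp w u.
Proof. by rewrite mulr_sumr; apply: eq_bigr => j _; rewrite mxE mulrCA. Qed.

Lemma dotpBr w u v : dotp w (u - v) = dotp w u - dotp w v.
Proof. by rewrite -scaleN1r dotpDr dotpZr mulN1r. Qed.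

Lemma dotp_sumr (I : finType) (p : pred I) w (F : I -> 'rV[R]_M) :
  dotp w (\sum_(i | p i) F i) = \sum_(i | p i) dotp w (F i).
Proof.
rewrite exchange_big; apply: eq_bigr => j _.
by rewrite summxE mulr_sumr.
Qed.

Lemma dotp_ge0 u : 0 <= dotp u u.
Proof. by apply: sumr_ge0 => j _; rewrite -expr2 sqr_ge0. Qed.

Lemma norm2_sqr u : norm2 u ^+ 2 = dotp u u.
Proof. by rewrite sqr_sqrtr// dotp_ge0. Qed.

Lemma dotp_sqr_le u v : dotp u v ^+ 2 <= dotp u u * dotp v v.
Proof.
set a := dotp u u; set b := dotp u v; set c := dotp v v.
have q r : 0 <= a - 2 * r * b + r ^+ 2 * c.
  have := dotp_ge0 (u - r *: v); congr (_ <= _).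
  rewrite dotpBr dotpZr !(dotpC (u - _)) !dotpBr !dotpZr (dotpC v u) -/a -/b -/c.
  by ring.
have [c0|c0] := leP c 0.
  have c_0 : c = 0 by apply/eqP; rewrite eq_le c0 dotp_ge0.
  have [->|b0] := eqVneq b 0; first by rewrite expr0n/= mulr_ge0 ?dotp_ge0.
  have := q ((a + 1) / (2 * b)).
  rewrite c_0 mulr0 addr0 (_ : 2 * _ * b = a + 1); last by field.
  lra.
have := q (b / c).
rewrite (_ : a - _ + _ = (a * c - b ^+ 2) / c); last by field; rewrite gt_eqF.
by rewrite pmulr_lge0 ?invr_gt0// subr_ge0.
Qed.

Lemma dotp_add_le u v :
  dotp (u + v) (u + v) <= 2 * dotp u u + 2 * dotp v v.
Proof.
have := dotp_ge0 (u - v).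
rewrite dotpBr dotpDr !(dotpC (u - _)) !(dotpC (u + _)) !dotpBr !dotpDr.
by rewrite (dotpC v u); lra.
Qed.

End EuclideanGeometry.

Section LeastSquares.
Context {R : realType} {M N : nat}.
Variable z : 'I_N -> M.-tuple R * R.
Let x i : 'rV[R]_M := tuple_vec (z i).1.
Let y i : R := (z i).2.

Lemma empirical_loss_shift t w : empirical_loss z (t + w) =
  empirical_loss z t - 2 * (\sum_i (y i - dotp (x i) t) * dotp (x i) w)
  + \sum_i dotp (x i) w ^+ 2.
Proof.
rewrite mulr_sumr -sumrB -big_split; apply: eq_bigr => i _ /=.
by rewrite dotpDr -/(x i) -/(y i); ring.
Qed.

Lemma erm_normal_equations t : is_erm z t ->
  forall w, \sum_i (y i - dotp (x i) t) * dotp (x i) w = 0.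
Proof.
move=> ermt w; set b := \sum_i _; apply/eqP/negP => /negP b0.
pose q := \sum_i dotp (x i) w ^+ 2.
have q0 : 0 <= q by apply: sumr_ge0 => i _; rewrite sqr_ge0.
(* if b != 0, the step s = b / (1 + q) along w decreases the loss *)
have := ermt (t + (b / (1 + q)) *: w); rewrite empirical_loss_shift.
set s := b / (1 + q).
rewrite (eq_bigr (fun i => s * ((y i - dotp (x i) t) * dotp (x i) w))); last first.
  by move=> i _; rewrite dotpZr mulrCA.
rewrite -mulr_sumr -/b.
rewrite [X in _ + X](eq_bigr (fun i => s ^+ 2 * dotp (x i) w ^+ 2)); last first.
  by move=> i _; rewrite dotpZr exprMn.
rewrite -mulr_sumr -/q.
have bs : b = s * (1 + q) by rewrite /s divfK// gt_eqF// ltr_pwDl.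
have s0 : 0 < s ^+ 2.
  rewrite exprn_even_gt0//=; apply: contra_neq b0 => s0.
  by rewrite bs s0 mul0r.
by rewrite bs; nra.
Qed.

Lemma normal_equations_erm t :
  (forall w, \sum_i (y i - dotp (x i) t) * dotp (x i) w = 0) -> is_erm z t.
Proof.
move=> ne s; rewrite -[s](subrKC t) empirical_loss_shift ne mulr0 subr0.
by rewrite lerDl sumr_ge0// => i _; rewrite sqr_ge0.
Qed.

(** The normal equations are solvable for any design [A] because [A] and
    [A^T *m A] have the same row space over an ordered field. *)
Lemma erm_exists : exists t, is_erm z t.
Proof.
pose A : 'M[R]_(N, M) := \matrix_(i, j) x i 0 j.
pose yv : 'rV[R]_N := \row_i y i.
pose C := cokermx (A^T *m A).
have AC0 : A *m C = 0.
  have e : (A *m C)^T *m (A *m C) = 0.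
    by rewrite trmx_mul -!mulmxA mulmxA -[C^T *m _ *m _]mulmxA mulmxA
      -mulmxA (mulmxA A^T) mulmx_coker mulmx0.
  apply/matrixP => i j; move/matrixP : e => /(_ j j); rewrite !mxE => /eqP.
  rewrite (eq_bigr (fun i => (A *m C) i j ^+ 2)); last first.
    by move=> l _; rewrite mxE expr2.
  rewrite psumr_eq0; last by move=> l _; rewrite sqr_ge0.
  by move=> /allP/(_ i (mem_index_enum _)); rewrite sqrf_eq0 mxE => /eqP.
have /submxP[t tE] : (yv *m A <= A^T *m A)%MS.
  by rewrite submxE -mulmxA AC0 mulmx0.
exists t; apply: normal_equations_erm => w.
have row j : \sum_i (y i - dotp (x i) t) * x i 0 j = 0.
  move/matrixP : tE => /(_ 0 j); rewrite mulmxA !mxE => e.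
  apply/eqP; under eq_bigr do rewrite mulrBl; rewrite sumrB subr_eq0; apply/eqP.
  transitivity (\sum_i yv 0 i * A i j); first by apply: eq_bigr => i _; rewrite !mxE.
  rewrite e; apply: eq_bigr => i _; rewrite !mxE; congr (_ * _).
  by apply: eq_bigr => l _; rewrite !mxE mulrC.
under eq_bigr do rewrite mulr_sumr; rewrite exchange_big big1// => j _.
under eq_bigr do rewrite mulrA.
by rewrite -mulr_suml row mul0r.
Qed.

(** When a single response [k] is noisy, the normal equations tested against
    [x k] read [e * |x k|^2 = dotp v (G (x k))] with [G = \sum_i x_i x_i^T] the
    Gram operator, [v] the estimation error and [e] the noise; Cauchy-Schwarz then
    bounds the error from below without inverting [G]. *)
Lemma erm_error_ge (tstar t : 'rV[R]_M) (k : 'I_N) : is_erm z t ->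
  (forall i, i != k -> y i = dotp (x i) tstar) ->
  ((y k - dotp (x k) tstar) * dotp (x k) (x k)) ^+ 2 <=
  dotp (t - tstar) (t - tstar) *
  (2 * dotp (x k) (x k) ^+ 3 +
   2 * (dotp (\sum_(i | i != k) dotp (x i) (x k) *: x i)
             (\sum_(i | i != k) dotp (x i) (x k) *: x i))).
Proof.
move=> ermt noiseless; set v := t - tstar; set B := \sum_(i | _) _.
set e := y k - _; set Z := dotp (x k) (x k).
have -> : e * Z = dotp v (Z *: x k + B).
  have := erm_normal_equations ermt (x k); rewrite (bigD1 k)//=.
  rewrite (eq_bigr (fun i => - (dotp (x i) (x k) * dotp v (x i)))); last first.
    move=> i ik; rewrite noiseless// [dotp v _]dotpC /v dotpBr; ring.
  rewrite sumrN => /eqP; rewrite subr_eq0 => /eqP ne.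
  rewrite dotpDr dotpZr dotp_sumr.
  rewrite [X in _ = _ + X](eq_bigr (fun i => dotp (x i) (x k) * dotp v (x i)));
    last by move=> i _; rewrite dotpZr.
  by rewrite -ne [dotp v (x k)]dotpC /v dotpBr -/Z /e; ring.
apply: (le_trans (dotp_sqr_le _ _)); rewrite ler_wpM2l ?dotp_ge0//.
apply: (le_trans (dotp_add_le _ _)); rewrite lerD2r.
by rewrite dotpZr (dotpC (Z *: _)) dotpZr -/Z -expr2 -exprS.
Qed.

End LeastSquares.

(** * Monomials in independent variables *)

Lemma prod_count_mem (R : realType) (I : finType) (f : I -> R) (s : seq I) :
  \prod_(q <- s) f q = \prod_q f q ^+ count_mem q s.
Proof.
elim: s => [|x s ih]; first by rewrite big_nil big1.
rewrite big_cons ih /=; under [RHS]eq_bigr do rewrite exprD.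
rewrite big_split /=; congr (_ * _).
rewrite (bigD1 x)//= eqxx expr1 big1 ?mulr1// => q qx.
by rewrite eq_sym (negbTE qx).
Qed.

Lemma big_option (V : Type) (idx : V) (op : Monoid.com_law idx) (I : finType)
    (f : option I -> V) :
  \big[op/idx]_o f o = op (f None) (\big[op/idx]_i f (Some i)).
Proof.
rewrite (bigD1 None)//=; congr (op _ _).
rewrite (reindex_omap Some id)//=; last by case.
by apply: eq_bigl => i; rewrite eqxx.
Qed.

Section MonomialMoment.
Context {R : realType} {I : finType}.
Variable gm : nat -> R.
Hypotheses (gm0 : gm 0%N = 1) (gm1 : gm 1%N = 0).

(** The expectation of the monomial [\prod_(q <- s) g q] in independent copies
    [g q] of a variable with moments [gm]. *)
Definition monomial_moment (s : seq I) : R := \prod_q gm (count_mem q s).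

Lemma perm_monomial_moment s1 s2 :
  perm_eq s1 s2 -> monomial_moment s1 = monomial_moment s2.
Proof. by move=> /permP s12; apply: eq_bigr => q _; rewrite s12. Qed.

Lemma monomial_moment_nil : monomial_moment [::] = 1.
Proof. by rewrite /monomial_moment big1. Qed.

Lemma monomial_moment_cat q n s : q \notin s ->
  monomial_moment (nseq n q ++ s) = gm n * monomial_moment s.
Proof.
move=> qs; rewrite /monomial_moment (bigD1 q)//= [in RHS](bigD1 q)//=.
rewrite count_cat count_nseq /= eqxx mul1n (count_memPn qs) addn0 gm0 mul1r.
congr (_ * _); apply: eq_bigr => r rq.
by rewrite count_cat count_nseq /= eq_sym (negbTE rq) mul0n.
Qed.

Lemma monomial_moment_eq0 q s : count_mem q s = 1%N -> monomial_moment s = 0.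
Proof. by move=> qs; rewrite /monomial_moment (bigD1 q)//= qs gm1 mul0r. Qed.

End MonomialMoment.

Section EventMonomial.
Context {R : realType} {d : measure_display} {S : measurableType d}.
Variables (Q : probability S R) (N M : nat).
Variable F : 'I_N * option 'I_M -> S -> R.
Hypothesis mF : forall q, measurable_fun setT (F q).
Hypothesis indF : mutually_independent Q F.
Variables (D : 'I_N -> set R) (p : 'I_N -> R) (gm : nat -> R).
Hypothesis mD : forall i, measurable (D i).
Hypothesis Dp : forall i, has_mean Q (\1_(D i) \o F (i, None)) (p i).
Hypothesis Fgm : forall i j n, (n <= 4)%N ->
  has_mean Q (fun w => F (i, Some j) w ^+ n) (gm n).

(** A noise pattern contributes one indicator per observation, that is one more
    factor to a product over independent variables. *)
Lemma has_mean_event_monomial (s : seq ('I_N * 'I_M)) :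
  (forall q, (count_mem q s <= 4)%N) ->
  has_mean Q (fun w => (\prod_i \1_(D i) (F (i, None) w)) *
                       \prod_(q <- s) F (q.1, Some q.2) w)
    ((\prod_i p i) * monomial_moment gm s).
Proof.
move=> s4.
pose g (q : 'I_N * option 'I_M) : R -> R := match q with
  | (i, None) => \1_(D i)
  | (i, Some j) => fun x => x ^+ count_mem (i, j) s
  end.
pose m (q : 'I_N * option 'I_M) := match q with
  | (i, None) => p i
  | (i, Some j) => gm (count_mem (i, j) s)
  end.
have split (h : 'I_N * option 'I_M -> R) : \prod_q h q =
    (\prod_i h (i, None)) * \prod_(q : 'I_N * 'I_M) h (q.1, Some q.2).
  have /= e1 := pair_bigA *%R (fun i o => h (i, o)).
  have /= e2 := pair_bigA *%R (fun i j => h (i, Some j)).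
  rewrite -e2 -big_split /= (eq_bigr (fun q => h (q.1, q.2))); last by case.
  by rewrite -e1; apply: eq_bigr => i _; rewrite big_option.
have -> : (\prod_i p i) * monomial_moment gm s = \prod_q m q.
  by rewrite split; congr (_ * _); apply: eq_bigr => -[i j] _.
apply: (@eq_has_mean _ _ _ _ (fun w => \prod_q g q (F q w))).
  by move=> w; rewrite split (prod_count_mem _ s); congr (_ * _);
    apply: eq_bigr => -[i j] _.
apply: (has_mean_prod mF indF) => -[i [j|]] /=.
- exact: exprn_measurable.
- exact: measurable_indic.
- exact: Fgm.
- exact: Dp.
Qed.

End EventMonomial.

(** * The noise *)

Section UniformNoise.
Context {R : realType}.
Notation U := (uniform_prob (@ltr01 R)).

Lemma uniform_prob_itv (a b : R) : 0 <= a -> a <= b -> b <= 1 ->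
  U `[a, b[%classic = (b - a)%:E.
Proof.
move=> a0 ab b1.
rewrite -[LHS]/(\int[lebesgue_measure]_(x in `[a, b[) (uniform_pdf 0 1 x)%:E)%E.
rewrite (eq_integral (cst 1%E)); last first.
  move=> x; rewrite inE/= in_itv/= => /andP[ax xb].
  by rewrite /uniform_pdf subr0 invr1 (le_trans a0 ax) (ltW (lt_le_trans xb b1)).
rewrite integral_cst//= mul1e lebesgue_measure_itv/= lte_fin.
by rewrite lt_neqAle ab andbT; case: eqVneq => [->|_] /=; rewrite ?subrr ?EFinB.
Qed.

Lemma has_mean_uniform_itv (a b : R) : 0 <= a -> a <= b -> b <= 1 ->
  has_mean U \1_`[a, b[%classic (b - a).
Proof.
move=> a0 ab b1; have e := uniform_prob_itv a0 ab b1.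
suff <- : fine (U `[a, b[%classic) = b - a by exact: has_mean_indic.
by rewrite e.
Qed.

Variable p : R.
Hypotheses (p0 : 0 < p) (p1 : p <= 1).

Let half_ge0 : 0 <= p / 2. Proof. by move: p0; lra. Qed.
Let half_le : p / 2 <= p. Proof. by move: p0; lra. Qed.
Let half_le1 : p / 2 <= 1. Proof. by move: p0 p1; lra. Qed.

Let Ip : set R := `[0, p / 2[%classic.
Let In : set R := `[p / 2, p[%classic.
Let Ip_In u : Ip u -> In u -> False.
Proof. by rewrite /Ip /In /= !in_itv /= => /andP[? ?] /andP[? ?]; lra. Qed.

(** If the noise is nonzero with probability [p], variance one forces its
    squared size to be [1 / p]; equally likely signs give mean zero. *)
Definition noise (u : R) : R := (Num.sqrt p)^-1 * (\1_Ip u - \1_In u).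

Let active (u : R) : R := \1_Ip u + \1_In u.

Let noise_cases u : [\/ active u = 1 /\ noise u = (Num.sqrt p)^-1,
  active u = 1 /\ noise u = - (Num.sqrt p)^-1 | active u = 0 /\ noise u = 0].
Proof.
rewrite /active /noise !indicE.
case: (boolP (u \in Ip)) => [|_]; case: (boolP (u \in In)) => [|_].
- by rewrite !inE => h1 h2; case: (Ip_In h2 h1).
- by rewrite addr0 subr0 mulr1; constructor 1.
- by rewrite add0r sub0r mulrN1; constructor 2.
- by rewrite addr0 subr0 mulr0; constructor 3.
Qed.

Let sqrtpV2 : (Num.sqrt p)^-1 ^+ 2 = p^-1.
Proof. by rewrite exprVn sqr_sqrtr// ltW. Qed.

Let sqr_noise u : noise u ^+ 2 = p^-1 * active u.
Proof.
case: (noise_cases u) => -[-> ->]; first by rewrite sqrtpV2 mulr1.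
  by rewrite sqrrN sqrtpV2 mulr1.
by rewrite expr0n mulr0.
Qed.

Lemma measurable_noise : measurable_fun setT noise.
Proof.
apply: measurable_funM => //.
by apply: measurable_funB; apply: measurable_indic; exact: measurable_itv.
Qed.

Let has_mean_Ip : has_mean U \1_Ip (p / 2).
Proof.
by have := has_mean_uniform_itv (lexx 0) half_ge0 half_le1; rewrite subr0.
Qed.

Let has_mean_In : has_mean U \1_In (p / 2).
Proof.
have := has_mean_uniform_itv half_ge0 half_le p1.
by rewrite {1}[p in p - _]splitr addrK.
Qed.

Let has_mean_active : has_mean U active p.
Proof.
by have := has_meanD has_mean_Ip has_mean_In; rewrite -splitr.
Qed.

Lemma has_mean_noise : has_mean U noise 0.
Proof.
have := has_meanZ (Num.sqrt p)^-1 (has_meanB has_mean_Ip has_mean_In).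
by rewrite subrr mulr0.
Qed.

Lemma has_mean_noise_sqr : has_mean U (fun u => noise u ^+ 2) 1.
Proof.
have := has_meanZ p^-1 has_mean_active; rewrite mulVf ?gt_eqF//.
by apply: eq_has_mean => u; rewrite sqr_noise.
Qed.

(** The nonzero values of the noise as a measurable set: the residuals of a
    sample are only known to have the law of the noise. *)
Definition large_noise : set R := (fun y => y ^+ 2) @^-1` [set p^-1].

Lemma measurable_large_noise : measurable large_noise.
Proof.
rewrite /large_noise -[X in measurable X]setTI.
by apply: exprn_measurable.
Qed.

Lemma has_mean_large_noise : has_mean U (\1_large_noise \o noise) p.
Proof.
apply: (eq_has_mean _ has_mean_active) => u /=.
rewrite indicE /large_noise; case: (noise_cases u) => -[-> e].
- by rewrite mem_set//= e sqrtpV2.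
- by rewrite mem_set//= e sqrrN sqrtpV2.
- rewrite memNset//= e expr0n/= => /esym/eqP.
  by rewrite invr_eq0 gt_eqF.
Qed.

Lemma has_mean_no_noise : has_mean U (\1_[set 0] \o noise) (1 - p).
Proof.
apply: (eq_has_mean _ (has_meanB (has_mean_cst U 1) has_mean_active)) => u /=.
have s0 : (Num.sqrt p)^-1 != 0 by rewrite invr_eq0 gt_eqF// sqrtr_gt0.
rewrite indicE; case: (noise_cases u) => -[-> e].
- by rewrite subrr memNset//= e; exact/eqP.
- by rewrite subrr memNset//= e; apply/eqP; rewrite oppr_eq0.
- by rewrite subr0 mem_set.
Qed.

End UniformNoise.

(** * Independent samples of the linear model *)

Section Orthonormal.
Context {R : realType} {d : measure_display} {T : measurableType d}.
Variables (P : probability T R) (I : finType) (f : I -> T -> R).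
Hypothesis mf : forall i, measurable_fun setT (f i).
Hypothesis indf : mutually_independent P f.
Hypotheses (f1 : forall i, has_mean P (f i) 0)
  (f2 : forall i, has_mean P (fun w => f i w ^+ 2) 1).

(** A product [f i * f j] is a monomial in the family, with exponent 1 at both
    indices when they differ. *)
Lemma has_mean_orthonormal i j : has_mean P (fun w => f i w * f j w) (i == j)%:R.
Proof.
have [<-|ij] := eqVneq i j; first exact: f2.
pose g k : R -> R := if k \in [:: i; j] then id else cst 1.
pose m k : R := if k \in [:: i; j] then 0 else 1.
have prod2 (h : I -> R) : (forall k, k \notin [:: i; j] -> h k = 1) ->
    \prod_k h k = h i * h j.
  move=> h1; rewrite (bigD1 i)//= (bigD1 j) 1?eq_sym//= big1 ?mulr1// => k /andP[ki kj].
  by apply: h1; rewrite !inE negb_or ki kj.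
have := @has_mean_prod _ _ _ P I f mf indf g m.
rewrite (prod2 m); last by move=> k /negbTE; rewrite /m => ->.
have -> : m i = 0 by rewrite /m mem_head.
rewrite mul0r => h; apply: eq_has_mean (h _ _) => [w|k|k].
- rewrite prod2; last by move=> k /negbTE; rewrite /g => ->.
  by rewrite /g mem_head in_cons mem_head orbT.
- by rewrite /g; case: ifP => _; [exact: measurable_id|exact: measurable_cst].
- by rewrite /g /m; case: ifP => _; [exact: f1|exact: has_mean_cst].
Qed.

Lemma has_mean_sqr_lincomb (c : I -> R) :
  has_mean P (fun w => (\sum_i c i * f i w) ^+ 2) (\sum_i c i ^+ 2).
Proof.
have -> : \sum_i c i ^+ 2 = \sum_i \sum_j c i * c j * (i == j)%:R.
  apply: eq_bigr => i _; rewrite (bigD1 i)//= eqxx mulr1 -expr2 big1 ?addr0//.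
  by move=> j; rewrite eq_sym => /negbTE ->; rewrite mulr0.
apply: (@eq_has_mean _ _ _ _
    (fun w => \sum_i \sum_j c i * c j * (f i w * f j w))).
  move=> w; rewrite expr2 mulr_suml; apply: eq_bigr => i _.
  by rewrite mulr_sumr; apply: eq_bigr => j _; rewrite mulrACA.
apply: has_mean_sum => i _; apply: has_mean_sum => j _.
by apply: has_meanZ; exact: has_mean_orthonormal.
Qed.

End Orthonormal.

Section Sampling.
Context {R : realType} d' (T' : measurableType d') (P' : probability T' R).
Context dS (S : measurableType dS) (Q : probability S R).
Context dV (V : measurableType dV) (N : nat) (I : finType).
Variables (W : T' -> V) (Z : 'I_N -> S -> V) (C : I -> V -> R).
Hypotheses (mC : forall o, measurable_fun setT (C o)).
Hypothesis indZ : independent_family Q Z.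
Hypothesis lawZ : forall i, same_law Q P' (Z i) W.
Hypothesis indC : mutually_independent P' (fun o => C o \o W).

(** Sampling makes the rows independent and [indC] makes the coordinates of a
    row independent; the two product rules compose. *)
Lemma mutually_independent_sample :
  mutually_independent Q (fun q : 'I_N * I => C q.2 \o Z q.1).
Proof.
move=> A mA.
have mCA i o : measurable (C o @^-1` A (i, o)).
  by rewrite -[X in measurable X]setTI; exact: mC.
pose B i := \bigcap_o (C o @^-1` A (i, o)).
have mB i : measurable (B i) by apply: fin_bigcap_measurable => // o _; exact: mCA.
have -> : \bigcap_q ((C q.2 \o Z q.1) @^-1` A q) = \bigcap_i (Z i @^-1` B i).
  apply/seteqP; split => [w h i _ o _|w h [i o] _]; first exact: (h (i, o)).
  exact: h.
rewrite indZ//.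
transitivity (\prod_i \prod_o Q ((C o \o Z i) @^-1` A (i, o)))%E; last first.
  by rewrite pair_bigA; apply: eq_bigr => -[i o] _.
apply: eq_bigr => i _; rewrite (lawZ i (mB i)).
have -> : W @^-1` B i = \bigcap_o ((C o \o W) @^-1` A (i, o)) by [].
rewrite indC; last by move=> o; exact: mA.
by apply: eq_bigr => o _; apply: esym; exact: (lawZ i (mCA i o)).
Qed.

End Sampling.

Section Model.
Context {R : realType} {d : measure_display} {T : measurableType d}.
Variables (P : probability T R) (M : nat) (X : {RV P >-> M.-tuple R}).
Hypothesis gaussX : standard_gaussian P X.
Variable p : R.
Notation U := (uniform_prob (@ltr01 R)).
Notation RU := (measurableTypeR R).

(** The noise is built from an independent uniform variable adjoined to the
    space carrying the design. *)
Let P' : probability (T * RU)%type R := (P \x U)%E.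

Lemma extension_rectangle (A : set T) (B : set RU) : measurable A ->
  measurable B -> P' ((@fst T RU) @^-1` A `&` (@snd T RU) @^-1` B) = (P A * U B)%E.
Proof. by move=> mA mB; rewrite -product_measure1E. Qed.

Lemma same_law_extension_fst : same_law P' P (@fst T RU) id.
Proof.
move=> A mA; have := extension_rectangle mA measurableT.
by rewrite preimage_setT setIT probability_setT mule1.
Qed.

Lemma same_law_extension_snd : same_law P' U (@snd T RU) id.
Proof.
move=> B mB; have := extension_rectangle measurableT mB.
by rewrite preimage_setT setTI probability_setT mul1e.
Qed.

(** Index [None] stands for the noise, so that a whole observation is one
    independent family of real variables. *)
Definition design_noise (o : option 'I_M) (w : T * RU) : R :=
  if o is Some j then tnth (X w.1) j else noise p w.2.

Let mtnthX j : measurable_fun setT (fun w => tnth (X w) j).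
Proof. exact: (measurableT_comp (measurable_tnth j)). Qed.

Lemma measurable_design_noise o : measurable_fun setT (design_noise o).
Proof.
case: o => [j|] /=.
  exact: (measurableT_comp (mtnthX j) measurable_fst).
exact: (measurableT_comp (measurable_noise p) measurable_snd).
Qed.

Lemma independent_design_noise : mutually_independent P' design_noise.
Proof.
move=> A mA.
have mXA j : measurable ((fun w => tnth (X w) j) @^-1` A (Some j)).
  by rewrite -[X in measurable X]setTI; exact: mtnthX.
have mnA : measurable (noise p @^-1` A None).
  by rewrite -[X in measurable X]setTI; exact: measurable_noise.
have -> : \bigcap_o (design_noise o @^-1` A o) =
    (@fst T RU) @^-1` (\bigcap_j ((fun w => tnth (X w) j) @^-1` A (Some j))) `&`
    (@snd T RU) @^-1` (noise p @^-1` A None).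
  apply/seteqP; split => [w h|w [h1 h2] [j|] _]; last exact: h2.
    by split=> [j _|]; [exact: (h (Some j))|exact: (h None)].
  exact: h1.
rewrite extension_rectangle//; last exact: fin_bigcap_measurable.
rewrite gaussX.1; last by move=> j; exact: mA.
rewrite big_option /= muleC; congr (_ * _)%E.
  by rewrite -[LHS](same_law_extension_snd mnA).
by apply: eq_bigr => j _; rewrite -[LHS](same_law_extension_fst (mXA j)).
Qed.

Lemma has_mean_noise_comp (phi : R -> R) m : measurable_fun setT phi ->
  has_mean U (phi \o noise p) m -> has_mean P' (phi \o design_noise None) m.
Proof.
move=> mphi.
have mpn : measurable_fun setT (phi \o noise p : RU -> R).
  exact: measurableT_comp mphi (measurable_noise p).
have mid : measurable_fun setT (@id RU) by exact: measurable_id.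
have msnd : measurable_fun setT (@snd T RU) by exact: measurable_snd.
have law := same_law_sym same_law_extension_snd.
exact: (has_mean_same_law mid msnd law mpn).
Qed.

Lemma has_mean_design_comp j (phi : R -> R) m : measurable_fun setT phi ->
  has_mean (normal_prob 0 1) phi m ->
  has_mean P' (phi \o design_noise (Some j)) m.
Proof.
move=> mphi.
have lawXj : same_law (normal_prob 0 1) P' (@id RU) (design_noise (Some j)).
  move=> A mA; apply: esym; apply: etrans (gaussX.2 j A mA).
  have := mtnthX j measurableT mA; rewrite setTI => mXA.
  exact: (same_law_extension_fst mXA).
have mid : measurable_fun setT (@id RU) by exact: measurable_id.
exact: (has_mean_same_law (phi := phi) mid
  (measurable_design_noise (Some j)) lawXj mphi).
Qed.

End Model.

(** * Moments of the design under a noise pattern *)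

Section MonomialBounds.
Context {R : realType} {N M : nat}.
Variables (gm : nat -> R) (kappa : R).
Hypotheses (gm0 : gm 0%N = 1) (gm1 : gm 1%N = 0) (gm2 : gm 2%N = 1).
Hypotheses (gm4 : gm 4%N = kappa) (kappa0 : 0 <= kappa).
Notation I := ('I_N * 'I_M)%type.
Notation mm := (monomial_moment (I := I) gm).

Lemma monomial_moment2 q : mm [:: q; q] = 1.
Proof.
have := @monomial_moment_cat _ I gm gm0 q 2 [::] isT; rewrite /= => ->.
by rewrite gm2 mul1r monomial_moment_nil.
Qed.

Lemma monomial_moment22 q r : q != r -> mm [:: q; q; r; r] = 1.
Proof.
move=> qr; have := @monomial_moment_cat _ I gm gm0 q 2 [:: r; r].
rewrite /= => ->; first by rewrite gm2 mul1r monomial_moment2.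
by rewrite !inE orbb.
Qed.

Lemma monomial_moment4 q : mm [:: q; q; q; q] = kappa.
Proof.
have := @monomial_moment_cat _ I gm gm0 q 4 [::] isT; rewrite /= => ->.
by rewrite gm4 monomial_moment_nil// mulr1.
Qed.

Lemma monomial_moment22_le q r : mm [:: q; q; r; r] <= 1 + kappa * (q == r)%:R.
Proof.
have [<-|qr] := eqVneq q r; first by rewrite monomial_moment4 mulr1; lra.
by rewrite monomial_moment22// mulr0 addr0.
Qed.

(** A term of the expansion of [|B x_k|^2]. As [i] and [i'] differ from [k], the
    entry [(k, a)] occurs once unless [a = c]; then [(i, a)] occurs once unless
    [i = i'] or [a = b]. An entry occurring once makes the moment vanish. *)
Lemma monomial_moment6_le (k i i' : 'I_N) (a b c : 'I_M) : i != k -> i' != k ->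
  mm [:: (i, a); (k, a); (i, b); (i', c); (k, c); (i', b)] <=
  (a == c)%:R * ((a == b)%:R + (i == i')%:R * (1 + kappa)).
Proof.
move=> ik i'k; set s := [:: _; _; _; _; _; _].
have [ac|ac] := eqVneq a c; last first.
  rewrite mul0r (monomial_moment_eq0 gm1 (q := (k, a)))//= !xpair_eqE !eqxx.
  by rewrite (negbTE ik) (negbTE i'k) (eq_sym c) (negbTE ac).
have peel (t : seq I) : (k, a) \notin t ->
    perm_eq s (nseq 2 (k, a) ++ t) -> mm s = mm t.
  move=> kt /(perm_monomial_moment gm) ->.
  by rewrite (monomial_moment_cat gm0)// gm2 mul1r.
rewrite mul1r; have [ii'|ii'] := eqVneq i i'.
  rewrite (peel [:: (i, a); (i, a); (i, b); (i, b)]); first 1 last.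
  - by rewrite !inE !xpair_eqE eq_sym (negbTE ik).
  - by apply/permP => f /=; rewrite -ac -ii'; lia.
  apply: (le_trans (monomial_moment22_le _ _)).
  rewrite mul1r xpair_eqE eqxx; have := kappa0; case: (a == b) => /=; lra.
rewrite mul0r addr0 (peel [:: (i, a); (i, b); (i', a); (i', b)]); first 1 last.
- by rewrite !inE !xpair_eqE !(eq_sym k) (negbTE ik) (negbTE i'k).
- by apply/permP => f /=; rewrite -ac; lia.
have [<-|ab] := eqVneq a b.
  by rewrite monomial_moment22// xpair_eqE negb_and ii'.
rewrite (monomial_moment_eq0 gm1 (q := (i, a)))//= !xpair_eqE !eqxx.
by rewrite (eq_sym i') (negbTE ii') (eq_sym b) (negbTE ab).
Qed.

End MonomialBounds.

Section SampleBound.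
Context {R : realType} {d : measure_display} {S : measurableType d}.
Variables (Q : probability S R) (N M : nat).
Variable F : 'I_N * option 'I_M -> S -> R.
Hypothesis mF : forall q, measurable_fun setT (F q).
Hypothesis indF : mutually_independent Q F.
Variables (large : set R) (p : R) (gm : nat -> R) (kappa : R).
Hypothesis mlarge : measurable large.
Hypothesis Flarge : forall i, has_mean Q (\1_large \o F (i, None)) p.
Hypothesis Fzero : forall i, has_mean Q (\1_[set 0] \o F (i, None)) (1 - p).
Hypothesis Fgm : forall i j n, (n <= 4)%N ->
  has_mean Q (fun w => F (i, Some j) w ^+ n) (gm n).
Hypotheses (gm0 : gm 0%N = 1) (gm1 : gm 1%N = 0) (gm2 : gm 2%N = 1).
Hypotheses (gm4 : gm 4%N = kappa) (kappa0 : 0 <= kappa).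
Hypothesis MN : (M <= N)%N.

Definition design_row (i : 'I_N) (w : S) : 'rV[R]_M := \row_j F (i, Some j) w.

Definition row_sqnorm (k : 'I_N) (w : S) : R :=
  dotp (design_row k w) (design_row k w).

(** The squared norm of [B x_k], where [B] is the Gram operator of the rows
    other than [k]. *)
Definition interaction (k : 'I_N) (w : S) : R :=
  let B := \sum_(i | i != k)
    dotp (design_row i w) (design_row k w) *: design_row i w in
  dotp B B.

(** The indicator that [k] is the only noisy observation, as a product so that
    it multiplies monomials. *)
Definition only_noisy (k : 'I_N) (w : S) : R :=
  \prod_i \1_(if i == k then large else [set 0]) (F (i, None) w).

Let prob_only := p * (1 - p) ^+ N.-1.

Lemma has_mean_only_monomial (k : 'I_N) (s : seq ('I_N * 'I_M)) :
  (forall q, (count_mem q s <= 4)%N) ->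
  has_mean Q (fun w => only_noisy k w * \prod_(q <- s) F (q.1, Some q.2) w)
    (prob_only * monomial_moment gm s).
Proof.
move=> s4.
have -> : prob_only = \prod_i (if i == k then p else 1 - p).
  rewrite (bigD1 k)//= eqxx; congr (_ * _).
  rewrite (eq_bigr (fun=> 1 - p)) => [|i /negPf ->//].
  by rewrite big_const iter_mulr_1 (cardC1 k) card_ord.
apply: (has_mean_event_monomial mF indF) => // i.
- by case: eqP.
- by case: eqP.
Qed.

Lemma row_sqnormE k w : row_sqnorm k w = \sum_j F (k, Some j) w * F (k, Some j) w.
Proof. by apply: eq_bigr => j _; rewrite !mxE. Qed.

Lemma has_mean_row_sqnorm k :
  has_mean Q (fun w => only_noisy k w * row_sqnorm k w) (prob_only * M%:R).
Proof.
have -> : prob_only * M%:R =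
    \sum_(j < M) prob_only * monomial_moment gm [:: (k, j); (k, j)].
  under eq_bigr do rewrite monomial_moment2// mulr1.
  by rewrite sumr_const card_ord mulr_natr.
apply: (@eq_has_mean _ _ _ _ (fun w => \sum_(j < M) only_noisy k w *
    \prod_(q <- [:: (k, j); (k, j)]) F (q.1, Some q.2) w)).
  move=> w; rewrite row_sqnormE mulr_sumr; apply: eq_bigr => j _.
  by rewrite !big_cons big_nil mulr1.
apply: has_mean_sum => j _; apply: has_mean_only_monomial => q.
exact: (leq_trans (count_size _ _)).
Qed.

Let sum_eq_ord (n : nat) (a : 'I_n) : \sum_(b < n) (a == b)%:R = 1 :> R.
Proof.
rewrite (bigD1 a)//= eqxx big1 ?addr0// => b; rewrite eq_sym.
by move=> /negbTE ->.
Qed.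

Lemma has_mean_row_sqnorm_sqr k : exists2 v, v <= M%:R ^+ 2 + kappa * M%:R &
  has_mean Q (fun w => only_noisy k w * row_sqnorm k w ^+ 2) (prob_only * v).
Proof.
exists (\sum_(a < M) \sum_(b < M)
    monomial_moment gm [:: (k, a); (k, a); (k, b); (k, b)]).
  apply: (@le_trans _ _ (\sum_(a < M) \sum_(b < M) (1 + kappa * (a == b)%:R))).
    apply: ler_sum => a _; apply: ler_sum => b _.
    apply: (le_trans (monomial_moment22_le gm0 gm2 gm4 _ _)).
    by rewrite xpair_eqE eqxx.
  under eq_bigr do rewrite big_split /= -mulr_sumr sum_eq_ord sumr_const card_ord.
  by rewrite sumr_const card_ord -mulr_natr; lra.
rewrite mulr_sumr.
apply: (@eq_has_mean _ _ _ _ (fun w => \sum_(a < M) \sum_(b < M) only_noisy k w *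
    \prod_(q <- [:: (k, a); (k, a); (k, b); (k, b)]) F (q.1, Some q.2) w)).
  move=> w; rewrite row_sqnormE expr2 mulr_suml mulr_sumr; apply: eq_bigr => a _.
  rewrite !mulr_sumr; apply: eq_bigr => b _.
  by rewrite !big_cons big_nil mulr1 !mulrA.
apply: has_mean_sum => a _; rewrite mulr_sumr; apply: has_mean_sum => b _.
apply: has_mean_only_monomial => q.
exact: (leq_trans (count_size _ _)).
Qed.

Lemma interactionE k w : interaction k w =
  \sum_(b < M) \sum_(i | i != k) \sum_(i' | i' != k) \sum_(a < M) \sum_(c < M)
    \prod_(q <- [:: (i, a); (k, a); (i, b); (i', c); (k, c); (i', b)])
      F (q.1, Some q.2) w.
Proof.
apply: eq_bigr => b _; rewrite summxE mulr_suml; apply: eq_bigr => i _.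
rewrite mulr_sumr; apply: eq_bigr => i' _; rewrite !mxE /dotp.
rewrite mulr_suml mulr_suml; apply: eq_bigr => a _.
rewrite mulr_suml mulr_sumr; apply: eq_bigr => c _.
by rewrite !big_cons big_nil !mxE mulr1 !mulrA.
Qed.

(** Row [x_i] meets row [x_i'] in two ways: for [i != i'] only the [M] diagonal
    terms [a = b = c] survive, for [i = i'] about [M ^ 2] terms do. The total is
    [N ^ 2 * M + N * M ^ 2] up to constants, and [M <= N]. *)
Lemma has_mean_interaction k :
  exists2 v, v <= (2 + kappa) * N%:R ^+ 2 * M%:R &
  has_mean Q (fun w => only_noisy k w * interaction k w) (prob_only * v).
Proof.
exists (\sum_(b < M) \sum_(i | i != k) \sum_(i' | i' != k) \sum_(a < M) \sum_(c < M)
    monomial_moment gm [:: (i, a); (k, a); (i, b); (i', c); (k, c); (i', b)]).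
  pose f (b a c : 'I_M) (i i' : 'I_N) : R :=
    (a == c)%:R * ((a == b)%:R + (i == i')%:R * (1 + kappa)).
  have f0 b a c i i' : 0 <= f b a c i i'.
    rewrite mulr_ge0// addr_ge0// mulr_ge0//; have := kappa0; lra.
  have drop (g : 'I_N -> R) : (forall i, 0 <= g i) -> \sum_(i | i != k) g i <= \sum_i g i.
    by move=> g0; rewrite [leRHS](bigD1 k)//= lerDr.
  apply: (@le_trans _ _ (\sum_(b < M) \sum_i \sum_i' \sum_(a < M) \sum_(c < M) f b a c i i')).
    apply: ler_sum => b _; apply: le_trans (drop _ _) => [|i]; last first.
      by do 3![apply: sumr_ge0 => ? _]; exact: f0.
    apply: ler_sum => i ik; apply: le_trans (drop _ _) => [|i']; last first.
      by do 2![apply: sumr_ge0 => ? _]; exact: f0.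
    apply: ler_sum => i' i'k; do 2![apply: ler_sum => ? _].
    exact: (monomial_moment6_le gm0 gm1 gm2 gm4 kappa0).
  have inner b i i' : \sum_(a < M) \sum_(c < M) f b a c i i' =
      1 + M%:R * ((i == i')%:R * (1 + kappa)).
    under eq_bigr do rewrite -mulr_suml sum_eq_ord mul1r.
    rewrite big_split /= sumr_const card_ord -[_ *+ M]mulr_natl.
    congr (_ + _); apply: etrans (sum_eq_ord b); apply: eq_bigr => a _.
    by rewrite eq_sym.
  have mid b i : \sum_i' \sum_(a < M) \sum_(c < M) f b a c i i' =
      N%:R + M%:R * (1 + kappa).
    under eq_bigr do rewrite inner.
    rewrite big_split /= sumr_const card_ord -mulr_sumr -mulr_suml sum_eq_ord.
    by rewrite mul1r.
  under eq_bigr do under eq_bigr do rewrite mid.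
  under eq_bigr do rewrite sumr_const card_ord.
  rewrite sumr_const card_ord -[(_ + _) *+ N]mulr_natr -[_ *+ M]mulr_natr.
  have MNR : M%:R <= N%:R :> R by rewrite ler_nat.
  have M0R : 0 <= M%:R :> R by [].
  have k0 := kappa0.
  rewrite ler_wpM2r// expr2 mulrA ler_wpM2r// ?ler0n//.
  have : 0 <= (N%:R - M%:R) * (1 + kappa) by rewrite mulr_ge0 ?subr_ge0//; lra.
  lra.
rewrite mulr_sumr.
apply: (@eq_has_mean _ _ _ _ (fun w => \sum_(b < M) \sum_(i | i != k)
    \sum_(i' | i' != k) \sum_(a < M) \sum_(c < M) only_noisy k w *
    \prod_(q <- [:: (i, a); (k, a); (i, b); (i', c); (k, c); (i', b)])
      F (q.1, Some q.2) w)).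
  move=> w; rewrite interactionE mulr_sumr; apply: eq_bigr => b _.
  by do 4![rewrite mulr_sumr; apply: eq_bigr => ? _].
apply: has_mean_sum => b _; rewrite mulr_sumr; apply: has_mean_sum => i ik.
rewrite mulr_sumr; apply: has_mean_sum => i' i'k.
rewrite mulr_sumr; apply: has_mean_sum => a _.
rewrite mulr_sumr; apply: has_mean_sum => c _.
apply: has_mean_only_monomial => q /=.
have [qk|qk] := eqVneq q.1 k.
  have ne i0 j0 : i0 != k -> (i0, j0) == q = false.
    by move=> i0k; apply: contra_neqF i0k => /eqP qE; rewrite -qk -qE.
  rewrite !(fun j => ne i j ik) !(fun j => ne i' j i'k).
  by do 2!case: (_ == q).
have ne j0 : (k, j0) == q = false.
  by apply: contra_neqF qk => /eqP <-.
by rewrite !ne; do 4!case: (_ == q).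
Qed.

End SampleBound.

(** * A favourable event for least squares *)

Section GoodEvent.
Context {R : realType} {d : measure_display} {S : measurableType d}.
Variables (Q : probability S R) (N M : nat).
Variable F : 'I_N * option 'I_M -> S -> R.
Hypothesis mF : forall q, measurable_fun setT (F q).
Hypothesis indF : mutually_independent Q F.
Variables (large : set R) (p : R) (gm : nat -> R) (kappa : R).
Hypothesis mlarge : measurable large.
Hypothesis large0 : ~ large 0.
Hypothesis Flarge : forall i, has_mean Q (\1_large \o F (i, None)) p.
Hypothesis Fzero : forall i, has_mean Q (\1_[set 0] \o F (i, None)) (1 - p).
Hypothesis Fgm : forall i j n, (n <= 4)%N ->
  has_mean Q (fun w => F (i, Some j) w ^+ n) (gm n).
Hypotheses (gm0 : gm 0%N = 1) (gm1 : gm 1%N = 0) (gm2 : gm 2%N = 1).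
Hypotheses (gm4 : gm 4%N = kappa) (kappa0 : 0 <= kappa).
Hypotheses (M0 : (0 < M)%N) (MN : (M <= N)%N).
Hypotheses (p0 : 0 < p) (Np : N%:R * p <= 2^-1).

Notation sqn := (row_sqnorm F).
Notation inter := (interaction F).
Notation only := (only_noisy F large).

Let a : R := (2 * (1 + kappa) * M%:R)^-1.

(** The factors [16] make each of the two Markov bounds cost a quarter of the
    probability [(4 * (1 + kappa))^-1] granted by the second-moment method. *)
Definition row_sqnorm_cap : R := 16 * (1 + kappa) * M%:R.
Definition interaction_cap : R :=
  16 * (1 + kappa) * ((2 + kappa) * N%:R ^+ 2 * M%:R).

(** A polynomial minorant of the indicator of
    [M / 2 <= sqn <= row_sqnorm_cap /\ inter <= interaction_cap]: the first three
    terms are [1 - (1 - a (sqn - M / 2)) ^+ 2], a second-moment substitute for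
    the event [M / 2 <= sqn] with [a] chosen to make its mean at least
    [(4 * (1 + kappa))^-1], and the last two are Markov bounds. *)
Definition minorant (k : 'I_N) (w : S) : R :=
  (2 * a + a ^+ 2 * M%:R) * sqn k w - a ^+ 2 * sqn k w ^+ 2
  - (a * M%:R + a ^+ 2 * M%:R ^+ 2 / 4)
  - interaction_cap^-1 * inter k w - row_sqnorm_cap^-1 * sqn k w.

Definition good (k : 'I_N) (w : S) : Prop :=
  [/\ (forall i, (if i == k then large else [set 0]) (F (i, None) w)),
      M%:R / 2 <= sqn k w, sqn k w <= row_sqnorm_cap & inter k w <= interaction_cap].

Let M_gt0 : 0 < M%:R :> R. Proof. by rewrite ltr0n. Qed.
Let N_gt0 : 0 < N%:R :> R. Proof. by rewrite ltr0n (leq_trans M0). Qed.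
Let k1 : 0 < 1 + kappa. Proof. by have := kappa0; lra. Qed.
Let k2 : 0 < 2 + kappa. Proof. by have := kappa0; lra. Qed.
Let cap_gt0 : 0 < row_sqnorm_cap.
Proof. by rewrite !mulr_gt0. Qed.
Let icap_gt0 : 0 < interaction_cap.
Proof. by rewrite !mulr_gt0// exprn_gt0. Qed.
Let a_gt0 : 0 < a.
Proof. by rewrite invr_gt0 !mulr_gt0. Qed.

Lemma only_noisyE k w : only k w =
  (`[< forall i, (if i == k then large else [set 0]) (F (i, None) w) >])%:R.
Proof.
rewrite /only_noisy; case: asboolP => h.
  by rewrite big1 // => i _; rewrite indicE mem_set //; exact: (h i).
have [i hi] : exists i, ~ (if i == k then large else [set 0]) (F (i, None) w).
  by apply/existsNP.
by rewrite (bigD1 i)//= indicE memNset// mul0r.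
Qed.

Let sqn_ge0 k w : 0 <= sqn k w. Proof. exact: dotp_ge0. Qed.
Let inter_ge0 k w : 0 <= inter k w. Proof. exact: dotp_ge0. Qed.

Lemma minorant_le1 k w : minorant k w <= 1.
Proof.
have h1 : 0 <= interaction_cap^-1 * inter k w by rewrite mulr_ge0// invr_ge0 ltW.
have h2 : 0 <= row_sqnorm_cap^-1 * sqn k w by rewrite mulr_ge0// invr_ge0 ltW.
have := sqr_ge0 (1 - a * (sqn k w - M%:R / 2)).
rewrite /minorant; lra.
Qed.

Lemma minorant_le0 k w :
  ~ [/\ M%:R / 2 <= sqn k w, sqn k w <= row_sqnorm_cap & inter k w <= interaction_cap] ->
  minorant k w <= 0.
Proof.
have h1 : 0 <= interaction_cap^-1 * inter k w by rewrite mulr_ge0// invr_ge0 ltW.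
have h2 : 0 <= row_sqnorm_cap^-1 * sqn k w by rewrite mulr_ge0// invr_ge0 ltW.
have sq := sqr_ge0 (1 - a * (sqn k w - M%:R / 2)).
move=> bad; have [l1|l1] := ltP (sqn k w) (M%:R / 2).
  have : 0 <= a * (M%:R / 2 - sqn k w) * (2 + a * (M%:R / 2 - sqn k w)).
    have : 0 <= a * (M%:R / 2 - sqn k w) by rewrite mulr_ge0 ?subr_ge0// ltW.
    by move=> ?; rewrite mulr_ge0//; lra.
  rewrite /minorant; lra.
have [l2|l2] := ltP row_sqnorm_cap (sqn k w).
  have : 1 <= row_sqnorm_cap^-1 * sqn k w by rewrite mulrC ler_pdivlMr// mul1r ltW.
  rewrite /minorant; lra.
have [l3|l3] := ltP interaction_cap (inter k w).
  have : 1 <= interaction_cap^-1 * inter k w by rewrite mulrC ler_pdivlMr// mul1r ltW.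
  rewrite /minorant; lra.
by case: bad.
Qed.

Let p_le1 : p <= 1.
Proof.
have N1 : 1 <= N%:R :> R by rewrite ler1n (leq_trans M0).
have : p <= N%:R * p by rewrite ler_peMl// ltW.
by have := Np; lra.
Qed.

(** By Bernoulli's inequality the other observations are all noiseless with
    probability at least [1 - N * p]. *)
Lemma prob_only_noisy_ge : p / 2 <= p * (1 - p) ^+ N.-1.
Proof.
rewrite ler_pM2l//.
have bernoulli n : 1 - n%:R * p <= (1 - p) ^+ n.
  elim: n => [|n ih]; first by rewrite mul0r subr0 expr0.
  rewrite exprS; apply: (@le_trans _ _ ((1 - p) * (1 - n%:R * p))).
    rewrite -natr1; have : 0 <= n%:R * p * p by rewrite !mulr_ge0// ltW.
    lra.
  by rewrite ler_wpM2l// subr_ge0.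
apply: le_trans (bernoulli _).
have : N.-1%:R * p <= N%:R * p by rewrite ler_pM2r// ler_nat leq_pred.
by have := Np; lra.
Qed.

Lemma has_mean_minorant k : exists2 m, p / 2 * (8 * (1 + kappa))^-1 <= m &
  has_mean Q (fun w => only k w * minorant k w) m.
Proof.
have hsqn := has_mean_row_sqnorm mF indF mlarge Flarge Fzero Fgm gm0 gm2 k.
have [v2 v2le hsqn2] :=
  has_mean_row_sqnorm_sqr mF indF mlarge Flarge Fzero Fgm gm0 gm2 gm4 k.
have [v3 v3le hint] :=
  has_mean_interaction mF indF mlarge Flarge Fzero Fgm gm0 gm1 gm2 gm4 kappa0 MN k.
have hone : has_mean Q (only k) (p * (1 - p) ^+ N.-1).
  have := has_mean_only_monomial mF indF mlarge Flarge Fzero Fgm k (s := [::]) (fun=> isT).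
  rewrite monomial_moment_nil// mulr1.
  by apply: eq_has_mean => w; rewrite big_nil mulr1.
set pi := p * _ in hsqn hsqn2 hint hone.
have pi_ge : p / 2 <= pi by exact: prob_only_noisy_ge.
pose c := (2 * a + a ^+ 2 * M%:R) * M%:R - a ^+ 2 * v2
  - (a * M%:R + a ^+ 2 * M%:R ^+ 2 / 4) - interaction_cap^-1 * v3
  - row_sqnorm_cap^-1 * M%:R.
exists (pi * c); last first.
  have := has_meanB (has_meanB (has_meanB (has_meanB
    (has_meanZ (2 * a + a ^+ 2 * M%:R) hsqn) (has_meanZ (a ^+ 2) hsqn2))
    (has_meanZ (a * M%:R + a ^+ 2 * M%:R ^+ 2 / 4) hone))
    (has_meanZ interaction_cap^-1 hint)) (has_meanZ row_sqnorm_cap^-1 hsqn).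
  have -> : forall x y z u v : R, x * (pi * M%:R) - y * (pi * v2) - z * pi
      - u * (pi * v3) - v * (pi * M%:R) =
      pi * (x * M%:R - y * v2 - z - u * v3 - v * M%:R) by move=> *; ring.
  apply: eq_has_mean => w /=; rewrite /minorant; ring.
have c_ge : (8 * (1 + kappa))^-1 <= c.
  have am : a * M%:R = (2 * (1 + kappa))^-1.
    by rewrite /a; field; rewrite !gt_eqF.
  have i3 : interaction_cap^-1 * v3 <= (16 * (1 + kappa))^-1.
    rewrite mulrC ler_pdivrMr//; apply: (le_trans v3le).
    by rewrite /interaction_cap mulKf// gt_eqF// mulr_gt0.
  have l3 : row_sqnorm_cap^-1 * M%:R = (16 * (1 + kappa))^-1.
    by rewrite /row_sqnorm_cap; field; rewrite !gt_eqF.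
  have s2 : a ^+ 2 * v2 <= (a * M%:R) ^+ 2 * (1 + kappa).
    rewrite [leRHS](_ : _ = a ^+ 2 * (M%:R ^+ 2 * (1 + kappa))); last by ring.
    rewrite ler_wpM2l ?sqr_ge0//; apply: (le_trans v2le).
    have M1 : 1 <= M%:R :> R by rewrite ler1n.
    have : 0 <= kappa * (M%:R * (M%:R - 1)).
      by rewrite !mulr_ge0// ?subr_ge0// ltW.
    lra.
  have am2 : (a * M%:R) ^+ 2 * (1 + kappa) = (4 * (1 + kappa))^-1.
    by rewrite am; field; rewrite gt_eqF.
  have m2 : 0 <= (a * M%:R) ^+ 2 by rewrite sqr_ge0.
  have e8 : (8 * (1 + kappa))^-1 = (1 + kappa)^-1 / 8 by field; rewrite gt_eqF.
  have e16 : (16 * (1 + kappa))^-1 = (1 + kappa)^-1 / 16 by field; rewrite gt_eqF.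
  have e4 : (4 * (1 + kappa))^-1 = (1 + kappa)^-1 / 4 by field; rewrite gt_eqF.
  have e2 : (2 * (1 + kappa))^-1 = (1 + kappa)^-1 / 2 by field; rewrite gt_eqF.
  move: i3 l3 s2 am2 am; rewrite e8 e16 e4 e2 /c => i3 l3 s2 am2 am.
  set r := (1 + kappa)^-1 in i3 l3 am2 am *.
  rewrite am2 in s2.
  have -> : (2 * a + a ^+ 2 * M%:R) * M%:R = 2 * (a * M%:R) + (a * M%:R) ^+ 2 by ring.
  have -> : a * M%:R + a ^+ 2 * M%:R ^+ 2 / 4 = a * M%:R + (a * M%:R) ^+ 2 / 4 by ring.
  rewrite l3 am in m2 *.
  lra.
have c0 : 0 <= c by apply: le_trans c_ge; rewrite invr_ge0 mulr_ge0// ltW.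
apply: (@le_trans _ _ (p / 2 * c)); first by rewrite ler_wpM2l// divr_ge0// ltW.
by rewrite ler_wpM2r.
Qed.

(** At most one index is the only noisy one, so the weighted minorants sum to a
    minorant of an indicator; its mean bounds the probability from below. *)
Lemma good_event : exists2 A : set S,
  measurable A /\ ((N%:R * (p / 2 * (8 * (1 + kappa))^-1))%:E <= Q A)%E &
  forall w, A w -> exists k, good k w.
Proof.
have /choice[m /all_and2[mle hm]] : forall k, exists m,
    p / 2 * (8 * (1 + kappa))^-1 <= m /\
    has_mean Q (fun w => only k w * minorant k w) m.
  by move=> k; have [m h1 h2] := has_mean_minorant k; exists m.
have hsum := has_mean_sum (index_enum 'I_N) (fun k (_ : xpredT k) => hm k).
set f := (fun w => _) in hsum.
have mf := has_mean_measurable hsum.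
(* positivity of the sum of minorants is a measurable event by construction *)
pose A := [set w | 0 < f w].
have mA : measurable A.
  rewrite (_ : A = f @^-1` `]0, +oo[%classic).
    by rewrite -[X in measurable X]setTI; apply: mf => //; exact: measurable_itv.
  by apply/seteqP; split => w /=; rewrite in_itv /= andbT.
have only1 k k' w : only k w != 0 -> k' != k -> only k' w = 0.
  rewrite !only_noisyE; case: asboolP => [h _ kk'|]; last by rewrite eqxx.
  case: asboolP => // /(_ k); have := h k; rewrite eqxx eq_sym (negbTE kk').
  by move=> hl h0; case: large0; rewrite -h0.
have only01 k w : 0 <= only k w <= 1.
  by rewrite only_noisyE; case: asboolP => _ /=; rewrite lexx ler01.
exists A; last first.
  move=> w; rewrite /A /= => fw.
  have [k] : exists k, 0 < only k w * minorant k w.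
    apply/not_existsP => h; move: fw; rewrite ltNge => /negP; apply.
    by apply: sumr_le0 => k _; rewrite leNgt; apply/negP; exact: h.
  rewrite only_noisyE; case: asboolP => [hk|]; last by rewrite mul0r ltxx.
  rewrite mul1r => mk; exists k.
  have [[l1 l2 i2]|bad] := pselect [/\ M%:R / 2 <= sqn k w, sqn k w <= row_sqnorm_cap &
      inter k w <= interaction_cap]; first by split.
  by move: mk; rewrite ltNge (minorant_le0 bad).
split => //; rewrite -[leRHS]fineK ?fin_num_measure// lee_fin.
apply: (@le_trans _ _ (\sum_k m k)).
  rewrite mulr_natl -[X in _ *+ X](card_ord N) -sumr_const.
  by apply: ler_sum => k _; exact: mle.
apply: (le_has_mean hsum (has_mean_indic Q mA)) => w.
rewrite indicE; case: (boolP (w \in A)) => [_|]; last first.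
  by rewrite notin_setE /A /= => /negP; rewrite -leNgt.
have [[k ck]|none] := pselect (exists k, only k w != 0).
  rewrite /f (bigD1 k)//= big1 ?addr0; last first.
    by move=> k' kk'; rewrite (only1 k k')// mul0r.
  have /andP[h0 h1] := only01 k w.
  by apply: (le_trans (ler_wpM2l h0 (minorant_le1 k w))); rewrite mulr1.
rewrite /f big1 // => k _.
have [->|ck] := eqVneq (only k w) 0; first by rewrite mul0r.
by case: none; exists k.
Qed.

(** The factor in front of [N ^ 2 * M] when both terms of
    [2 * sqn ^+ 3 + 2 * inter] are replaced by their caps. *)
Definition error_cst : R :=
  2 * (16 * (1 + kappa)) ^+ 3 + 2 * (16 * (1 + kappa) * (2 + kappa)).

Lemma error_cst_gt0 : 0 < error_cst.
Proof. by rewrite addr_gt0// mulr_gt0// ?exprn_gt0// !mulr_gt0. Qed.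

(** Lemma [erm_error_ge] with [e ^+ 2 = p^-1] and [sqn >= M / 2]; as [M <= N], the
    second factor there is at most [error_cst * N ^ 2 * M]. *)
Lemma good_error_ge (z : 'I_N -> M.-tuple R * R) (tstar t : 'rV[R]_M) k w :
  (forall y, large y -> y ^+ 2 = p^-1) ->
  (forall i, tuple_vec (z i).1 = design_row F i w) ->
  (forall i, (z i).2 - dotp (tuple_vec (z i).1) tstar = F (i, None) w) ->
  good k w -> is_erm z t ->
  M%:R / (4 * error_cst * p * N%:R ^+ 2) <= dotp (t - tstar) (t - tstar).
Proof.
move=> largeE zx zy [noisy l1 l2 i2] ermt.
have := erm_error_ge (k := k) ermt (tstar := tstar).
rewrite zy (eq_bigr (fun i => dotp (design_row F i w) (design_row F k w) *:
  design_row F i w)); last by move=> i _; rewrite !zx.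
rewrite zx -/(sqn k w) -/(inter k w) => h.
have {h} : (F (k, None) w * sqn k w) ^+ 2 <= dotp (t - tstar) (t - tstar) *
    (2 * sqn k w ^+ 3 + 2 * inter k w).
  apply: h => i ik; apply/eqP; rewrite -subr_eq0 zy.
  by have := noisy i; rewrite (negbTE ik) => ->.
have /largeE e2 : large (F (k, None) w) by have := noisy k; rewrite eqxx.
rewrite exprMn e2; set D := dotp _ _; set Z := sqn k w in l1 l2 *.
set H := inter k w in i2 * => h.
have D0 : 0 <= D by exact: dotp_ge0.
have NM : N%:R ^+ 2 * M%:R > 0 :> R by rewrite mulr_gt0// exprn_gt0.
have cap : 2 * Z ^+ 3 + 2 * H <= error_cst * (N%:R ^+ 2 * M%:R).
  have Z3 : Z ^+ 3 <= (16 * (1 + kappa)) ^+ 3 * (N%:R ^+ 2 * M%:R).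
    apply: (@le_trans _ _ (row_sqnorm_cap ^+ 3)).
      by rewrite lerXn2r// nnegrE ?sqn_ge0// ltW.
    have c0 : 0 <= (16 * (1 + kappa)) ^+ 3 by rewrite exprn_ge0// mulr_ge0// ltW.
    rewrite /row_sqnorm_cap exprMn ler_wpM2l//.
    by rewrite exprSr ler_wpM2r// lerXn2r// ?nnegrE// ler_nat.
  move: i2; rewrite /interaction_cap /error_cst; lra.
have h2 : p^-1 * (M%:R / 2) ^+ 2 <= D * (error_cst * (N%:R ^+ 2 * M%:R)).
  apply: (@le_trans _ _ (p^-1 * Z ^+ 2)).
    have M20 : 0 <= M%:R / 2 :> R by rewrite divr_ge0.
    by rewrite ler_pM2l ?invr_gt0// lerXn2r// nnegrE// (le_trans M20).
  by apply: (le_trans h); rewrite ler_wpM2l.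
have ec := error_cst_gt0.
have -> : M%:R / (4 * error_cst * p * N%:R ^+ 2) =
    p^-1 * (M%:R / 2) ^+ 2 / (error_cst * (N%:R ^+ 2 * M%:R)).
  by field; rewrite !gt_eqF.
by rewrite ler_pdivrMr// mulr_gt0.
Qed.

End GoodEvent.

(** * Risk in the linear model *)

Section ModelRisk.
Context {R : realType} {d : measure_display} {T : measurableType d}.
Variables (P : probability T R) (M : nat) (X : {RV P >-> M.-tuple R}).
Hypothesis gaussX : standard_gaussian P X.
Variable p : R.
Hypotheses (p0 : 0 < p) (p1 : p <= 1).
Notation U := (uniform_prob (@ltr01 R)).
Notation RU := (measurableTypeR R).
Let P' : probability (T * RU)%type R := (P \x U)%E.
Notation G := (design_noise X p).

Let hasG1 o : has_mean P' (G o) 0.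
Proof.
case: o => [j|].
  by have := has_mean_design_comp gaussX p j (@measurable_id _ R setT)
    (has_mean_gauss_id (R := R)).
by have := has_mean_noise_comp X (@measurable_id _ R setT) (has_mean_noise p0 p1).
Qed.

Let hasG2 o : has_mean P' (fun w => G o w ^+ 2) 1.
Proof.
case: o => [j|].
  by have := has_mean_design_comp gaussX p j (@exprn_measurable R setT 2)
    (has_mean_gauss_sqr (R := R)).
by have := has_mean_noise_comp X (@exprn_measurable R setT 2) (has_mean_noise_sqr p0 p1).
Qed.

Lemma expectation_design_noise : ('E_P'[G None] = 0)%E.
Proof. by rewrite unlock; exact: (hasG1 None).2. Qed.

Lemma variance_design_noise : ('V_P'[G None] = 1)%E.
Proof.
rewrite /variance unlock expectation_design_noise /= unlock.
apply: etrans (hasG2 None).2; apply: eq_integral => w _.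
by congr (_%:E); rewrite /GRing.mul /= subr0 expr2.
Qed.

(** The residual at [t] is a linear combination of centred, uncorrelated, unit
    variance variables, with coefficient [1] on the noise. *)
Lemma risk_linear_model (tstar t : 'rV[R]_M) :
  risk P' (fun w => X w.1) (linear_model (fun w => X w.1) (G None) tstar) t =
  (1 + dotp (t - tstar) (t - tstar))%:E.
Proof.
pose c (o : option 'I_M) : R := if o is Some j then (tstar - t) 0 j else 1.
have := has_mean_sqr_lincomb (measurable_design_noise X p)
  (independent_design_noise gaussX p) hasG1 hasG2 c.
rewrite big_option expr1n (_ : \sum_j _ = dotp (t - tstar) (t - tstar)); last first.
  by apply: eq_bigr => j _; rewrite /= !mxE -expr2 -sqrrN opprB.
case=> _ <-; rewrite /risk unlock; apply: eq_integral => w _; congr (_ ^+ 2)%:E.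
rewrite big_option /= mul1r /linear_model addrAC -dotpBr addrC; congr (_ + _).
by apply: eq_bigr => j _; rewrite !mxE mulrC.
Qed.

End ModelRisk.

(** * Coordinates of the sample *)

Section SampledModel.
Context {R : realType} {d : measure_display} {T : measurableType d}.
Variables (P : probability T R) (M : nat) (X : {RV P >-> M.-tuple R}).
Hypothesis gaussX : standard_gaussian P X.
Variable p : R.
Variable tstar : 'rV[R]_M.
Notation U := (uniform_prob (@ltr01 R)).
Notation RU := (measurableTypeR R).
Let P' : probability (T * RU)%type R := (P \x U)%E.
Notation G := (design_noise X p).

(** The residual recovers the noise from an observation, so the law of an
    observation determines that of the whole family [design_noise]. *)
Definition coordinate (o : option 'I_M) (v : M.-tuple R * R) : R :=
  if o is Some j then tnth v.1 j else v.2 - dotp (tuple_vec v.1) tstar.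

Definition observation (w : T * RU) : M.-tuple R * R :=
  (X w.1, linear_model (fun w => X w.1) (G None) tstar w).

Lemma coordinate_observation o w : coordinate o (observation w) = G o w.
Proof. by case: o => [j|] //=; rewrite /linear_model addrC addKr. Qed.

Lemma measurable_dotp_tuple d' (V : measurableType d') (f : V -> M.-tuple R)
    (u : 'rV[R]_M) : measurable_fun setT f ->
  measurable_fun setT (fun v => dotp (tuple_vec (f v)) u).
Proof.
move=> mf; apply: measurable_sum => j; apply: measurable_funM => //.
under eq_fun do rewrite mxE.
exact: (measurableT_comp (measurable_tnth j)).
Qed.

Lemma measurable_coordinate o : measurable_fun setT (coordinate o).
Proof.
case: o => [j|].
  exact: (measurableT_comp (measurable_tnth j) measurable_fst).
by apply: measurable_funB => //; apply: measurable_dotp_tuple.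
Qed.

Lemma measurable_observation : measurable_fun setT observation.
Proof.
have mX : measurable_fun setT (fun w : T * RU => X w.1).
  exact: (measurableT_comp _ measurable_fst).
apply: measurable_fun_pair => //; apply: measurable_funD.
  exact: measurable_dotp_tuple.
exact: (measurable_design_noise X p None).
Qed.

Variables (dS : measure_display) (S : measurableType dS) (Q : probability S R).
Variables (N : nat) (Z : 'I_N -> {RV Q >-> (M.-tuple R * R)%type}).
Hypothesis indZ : independent_family Q (fun i => Z i : S -> M.-tuple R * R).
Hypothesis lawZ : forall i, same_law Q P' (Z i) observation.

Definition sample_coordinate (q : 'I_N * option 'I_M) : S -> R :=
  coordinate q.2 \o Z q.1.

Lemma measurable_sample_coordinate q : measurable_fun setT (sample_coordinate q).
Proof. exact: (measurableT_comp (measurable_coordinate q.2)). Qed.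

Lemma independent_sample_coordinate : mutually_independent Q sample_coordinate.
Proof.
apply: (mutually_independent_sample measurable_coordinate indZ lawZ).
have -> : (fun o => coordinate o \o observation) = G.
  by apply/funext => o; apply/funext => w; exact: coordinate_observation.
exact: independent_design_noise.
Qed.

Lemma has_mean_sample_coordinate i o (phi : R -> R) m : measurable_fun setT phi ->
  has_mean P' (phi \o G o) m -> has_mean Q (phi \o sample_coordinate (i, o)) m.
Proof.
move=> mphi h.
have mpc : measurable_fun setT (phi \o coordinate o).
  exact: measurableT_comp mphi (measurable_coordinate o).
apply: (has_mean_same_law measurable_observation (@measurable_funPT _ _ _ _ (Z i))
  (same_law_sym (lawZ i)) mpc).
by apply: eq_has_mean h => w /=; rewrite coordinate_observation.
Qed.

End SampledModel.

Theorem proposition1p5 (R : realType) :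
  exists c0 c1 c2 : R, [/\ 0 < c0, 0 < c1 & 0 < c2] /\
  forall (x : R) (N M : nat),
    1 <= x -> (0 < N)%N -> (0 < M)%N -> c0 * M%:R <= N%:R ->
  forall (d : measure_display) (T : measurableType d) (P : probability T R)
    (X : {RV P >-> M.-tuple R}),
    standard_gaussian P X ->
  (* [zeta] lives on an extension [proj : T' -> T] of the space carrying [X] *)
  exists (d' : measure_display) (T' : measurableType d')
    (P' : probability T' R) (proj : {mfun T' >-> T}) (zeta : {RV P' >-> R}),
    [/\ same_law P' P proj id,
        independent_pair P' (X \o proj) zeta,
        ('E_P'[zeta] = 0)%E &
        ('V_P'[zeta] = 1)%E] /\
  forall (tstar : 'rV[R]_M),
  let Y := linear_model (X \o proj) zeta tstar in
  let risk := risk P' (X \o proj) Y in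
  forall (dS : measure_display) (S : measurableType dS) (Q : probability S R)
    (Z : 'I_N -> {RV Q >-> (M.-tuple R * R)%type}),
    independent_family Q (fun i => Z i : S -> M.-tuple R * R) ->
    (forall i, same_law Q P' (Z i) (fun w => ((X \o proj) w, Y w))) ->
  exists2 A : set S, measurable A /\ ((c1 / x)%:E <= Q A)%E &
    forall w, A w ->
      let z := fun i => Z i w in
      (exists that, is_erm z that) /\
      forall that, is_erm z that ->
        ((norm2 (that - tstar) ^+ 2)%:E = risk that - risk tstar)%E /\
        ((c2 * x * M%:R / N%:R)%:E <= risk that - risk tstar)%E.
Proof.
have [gm [gm0 gm1 gm2 kappa0] hgm] := gaussian_moments R.
set kappa := gm 4%N in kappa0.
have k1 : 0 < 1 + kappa by lra.
have ec0 := error_cst_gt0 kappa0.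
exists 1, (32 * (1 + kappa))^-1, (2 * error_cst kappa)^-1.
split; first by split=> //; rewrite invr_gt0 mulr_gt0.
move=> x N M x1 N0 M0; rewrite mul1r ler_nat => MN d T P X gaussX.
have x0 : 0 < x by lra.
have NR : 0 < N%:R :> R by rewrite ltr0n.
pose p := (2 * x * N%:R)^-1.
have p0 : 0 < p by rewrite invr_gt0 !mulr_gt0.
have Np : N%:R * p <= 2^-1.
  rewrite (_ : N%:R * p = x^-1 / 2); last by rewrite /p; field; rewrite !gt_eqF.
  by rewrite ler_piMl// invf_le1.
have p1 : p <= 1.
  have N1 : 1 <= N%:R :> R by rewrite ler1n.
  have : p <= N%:R * p by rewrite ler_peMl// ltW.
  lra.
pose RU := measurableTypeR R.
pose P' : probability (T * RU)%type R := (P \x uniform_prob (@ltr01 R))%E.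
pose proj : {mfun (T * RU)%type >-> T} :=
  HB.pack (@fst T RU) (isMeasurableFun.Build _ _ _ _ _ measurable_fst).
pose zeta : {mfun (T * RU)%type >-> R} := HB.pack (design_noise X p None)
  (isMeasurableFun.Build _ _ _ _ _ (measurable_design_noise X p None)).
exists _, (T * RU)%type, P', proj, zeta; split.
  split.
  - exact: same_law_extension_fst.
  - move=> A B mA mB.
    have mXA : measurable (X @^-1` A).
      by rewrite -[X in measurable X]setTI; exact: measurable_funPT.
    have mnB : measurable (noise p @^-1` B).
      by rewrite -[X in measurable X]setTI; exact: measurable_noise.
    rewrite -[P' (zeta @^-1` B)](esym (same_law_extension_snd P mnB)).
    rewrite -[P' (_ @^-1` A)](esym (same_law_extension_fst P mXA)).
    exact: (extension_rectangle P mXA mnB).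
  - exact: expectation_design_noise.
  - exact: variance_design_noise.
move=> tstar Y risk dS S Q Z indZ lawZ.
have lawZ' : forall i, same_law Q P' (Z i) (observation X p tstar) by exact: lawZ.
pose F := sample_coordinate tstar Z.
have hF i o (phi : R -> R) m := @has_mean_sample_coordinate _ _ _ P _ X p tstar
  _ _ Q _ Z lawZ' i o phi m.
have [A [mA QA] goodA] : exists2 A : set S, measurable A /\
    ((N%:R * (p / 2 * (8 * (1 + kappa))^-1))%:E <= Q A)%E &
    forall w, A w -> exists k, good F (large_noise p) kappa k w.
  apply: (@good_event _ _ _ Q N M F _ _ (large_noise p) p gm kappa) => //.
  - exact: measurable_sample_coordinate.
  - exact: (independent_sample_coordinate gaussX indZ lawZ').
  - exact: measurable_large_noise.
  - rewrite /large_noise /= expr0n /= => /esym/eqP.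
    by rewrite invr_eq0 gt_eqF.
  - move=> i; apply: hF; first by apply: measurable_indic; exact: measurable_large_noise.
    apply: has_mean_noise_comp; last exact: has_mean_large_noise.
    by apply: measurable_indic; exact: measurable_large_noise.
  - move=> i; apply: hF; first exact: measurable_indic.
    apply: has_mean_noise_comp; last exact: has_mean_no_noise.
    exact: measurable_indic.
  - move=> i j n n4; apply: (hF _ _ (fun x => x ^+ n)); first exact: exprn_measurable.
    apply: (has_mean_design_comp gaussX _ _ (phi := fun x => x ^+ n)); last exact: hgm.
    exact: exprn_measurable.
exists A.
  split => //; apply: le_trans QA; rewrite lee_fin le_eqVlt; apply/orP; left.
  by apply/eqP; rewrite /p; field; rewrite !gt_eqF.
move=> w /goodA[k gk] z; split; first exact: erm_exists.
move=> that ermt.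
have riskE t : risk t = (1 + dotp (t - tstar) (t - tstar))%:E.
  exact: (risk_linear_model gaussX p0 p1).
have -> : (risk that - risk tstar = (dotp (that - tstar) (that - tstar))%:E)%E.
  rewrite !riskE -EFinB subrr; congr (_%:E).
  by rewrite [dotp 0 0]big1 ?addr0 => [|j _]; [rewrite addrC addKr|rewrite mxE mul0r].
split; first by rewrite norm2_sqr.
have := good_error_ge kappa0 M0 MN p0 (z := z) (tstar := tstar) (t := that)
  (k := k) (w := w) (F := F) (large := large_noise p) (fun y h => h) _ _ gk ermt.
rewrite lee_fin => h; apply: le_trans (h _ _) => [|i|i].
- by rewrite le_eqVlt; apply/orP; left; apply/eqP; rewrite /p; field; rewrite !gt_eqF.
- by apply/rowP => j; rewrite !mxE.
- by [].
Qed.
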